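(* Let $S_2\subset\mathbb{P}^3$ be the cubic surface $$S_2=\{[x_1,x_2,x_3,x_4]\in\mathbb{P}^3:\ x_1x_2(x_1+x_2)+x_4(x_1+x_2+x_3)^2=0\},$$ and let $U_2\subset S_2$ be the Zariski open subset obtained by deleting from $S_2$ the six lines $$x_i=x_4=0,\qquad x_1+x_2=x_j=0,\qquad x_i=x_1+x_2+x_3=0,\qquad (i\in\{1,2\},\ j\in\{3,4\}).$$ For $B\geq 1$ let $N_{U_2}(B)=\#\{x\in U_2(\mathbb{Q}): H(x)\leq B\}$. Then for all $B\geq 2$, $$N_{U_2}(B)\ll B(\log B)^6 .$$
   Context: For a point $x\in\mathbb{P}^{n-1}(\mathbb{Q})$ written as $x=[\mathbf{x}]$ with $\mathbf{x}=(x_1,\dots,x_n)\in\mathbb{Z}^n$ and $\gcd(x_1,\dots,x_n)=1$, the height is $H(x)=\max_i|x_i|$. The notation $A\ll B$ means $|A|\leq cB$ for an absolute constant $c>0$. *)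

(* Defs.v *)
From Stdlib Require Import Reals ZArith List Bool.
Import ListNotations.
Open Scope Z_scope.
Open Scope bool_scope.

(** A point of P^3(Q) is represented by a primitive integer vector
    (x1,x2,x3,x4) (gcd = 1), normalised so that its first nonzero
    coordinate is positive; this picks exactly one of the two primitive
    representatives +-x of each rational point. *)

Definition cubic_S2 (x1 x2 x3 x4 : Z) : Z :=
  x1 * x2 * (x1 + x2) + x4 * (x1 + x2 + x3) ^ 2.

Definition on_six_lines (x1 x2 x3 x4 : Z) : bool :=
  ((x1 =? 0) && (x4 =? 0)) || ((x2 =? 0) && (x4 =? 0)) ||
  ((x1 + x2 =? 0) && (x3 =? 0)) || ((x1 + x2 =? 0) && (x4 =? 0)) ||
  ((x1 =? 0) && (x1 + x2 + x3 =? 0)) || ((x2 =? 0) && (x1 + x2 + x3 =? 0)).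

Definition primitive4 (x1 x2 x3 x4 : Z) : bool :=
  Z.gcd (Z.gcd (Z.gcd x1 x2) x3) x4 =? 1.

Definition sign_normalised (x1 x2 x3 x4 : Z) : bool :=
  (0 <? x1) || ((x1 =? 0) && ((0 <? x2) || ((x2 =? 0) &&
  ((0 <? x3) || ((x3 =? 0) && (0 <? x4)))))).

Definition height4 (x1 x2 x3 x4 : Z) : Z :=
  Z.max (Z.max (Z.abs x1) (Z.abs x2)) (Z.max (Z.abs x3) (Z.abs x4)).

Definition in_U2 (x1 x2 x3 x4 : Z) : bool :=
  (cubic_S2 x1 x2 x3 x4 =? 0) && negb (on_six_lines x1 x2 x3 x4).

Definition zbox (M : nat) : list Z :=
  map (fun k => Z.of_nat k - Z.of_nat M) (seq 0 (2 * M + 1)).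

Definition box4 (M : nat) : list (Z * Z * Z * Z) :=
  list_prod (list_prod (list_prod (zbox M) (zbox M)) (zbox M)) (zbox M).

(** N_{U_2}(B) = #{x in U_2(Q) : H(x) <= B}.  Every point with H(x) <= B
    has a representative in the box [-M,M]^4 with M = |up B|, since
    |x_i| <= B < up B. *)
Definition N_U2 (B : R) : nat :=
  length (filter
    (fun v : Z * Z * Z * Z =>
       let '(x1, x2, x3, x4) := v in
       primitive4 x1 x2 x3 x4 && sign_normalised x1 x2 x3 x4 &&
       in_U2 x1 x2 x3 x4 &&
       (if Rle_dec (IZR (height4 x1 x2 x3 x4)) B then true else false))
    (box4 (Z.abs_nat (up B)))).

(* Main.v *)
Require Import Defs.
From Stdlib Require Import Reals.
From Stdlib Require Import List ZArith Znumtheory Lia Lra ClassicalEpsilon.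
Open Scope R_scope.

(** Put [a = x1], [b = x2], [c = -(a + b)] and [y = x1 + x2 + x3]: the surface becomes [a + b + c = 0],
    [a b c = x4 y^2], and all of [a, b, c, x4, y] are nonzero off the lines. Splitting off common
    factors, [a = d s t^2 s1 A1 y1^2] and similarly for [b, c], with [s = s1 s2 s3],
    [x4 = d^3 A1 A2 A3], [|y| = s^2 t^3 y1 y2 y3], the [si Ai yi] pairwise coprime and
    [s1 A1 y1^2 + s2 A2 y2^2 + s3 A3 y3^2 = 0].

    Localise [Ai ~ 4^ai] and [yi ~ 8^bi], let [X], [Y] be the products of these sizes, and let
    [Z1] be the largest of the sizes of the three terms [si Ai yi^2]. For fixed [y] the [A] are
    primitive points of a plane lattice, so a box contains [O(Y (1 + X/Z1))] solutions. For fixed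
    [A] the solutions [y] are points of a conic lying in few lattices of determinant about [X]; three
    of them which are close have determinant zero, which is absurd, so a box contains
    [O(L^3 sqrt(X Y))] solutions if [X <= Y], where [L] is about [log B].

    If [X >= Z1], the bound [X Y / Z1] is geometric in [y1, y2, y3] and in one of the [Ai], leaving two
    logarithms from the other [Ai] and four from [s1, s2, s3, t]. If [X < Z1], the [O((B/X)^(1/3))]
    values of [d] and the minimum of [Y] and [L^3 sqrt(X Y)] give [B^(1/3) L^2 Y^(2/3)]; this is
    geometric in one [yi], the sums over the [si] and [t] converge, and four logarithms remain
    because [a1] is determined up to [O(1)] by the other sizes. *)

(** * Counting by fibers *)

(** The bound [B (log B)^6] leaves no room for a factor [B^eps], so a pointwise divisor bound cannot
    be used for the number of lattices attached to one conic. What is counted instead is pairs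
    formed by [Ai] and a divisor of it, over a whole dyadic range of [Ai]: each index costs one
    logarithm, which gives the [L^3]. Interpolating [Y] and [L^3 sqrt(X Y)] with exponents 1/3 and
    2/3 turns [L^3] into [L^2] and produces [X^(1/3)], which cancels against the number of [d]. The
    condition [s^2 t^3 Y << B] then yields [s^(-4/3) t^(-2)], so the sums over the [si] and [t]
    converge. When [X >= Z1], summing [X Y / Z1] over the four geometric variables leaves
    [B / (d^2 s1 s2 s3 t)]: convergent in [d], harmonic in the other four. The sizes enter through
    square roots for [Ai] and cube roots for [yi]; the bases 4 and 8 make these roots powers of 2,
    so that every geometric sum has ratio at least 2. *)

Definition at_most {T : Type} (P : T -> Prop) (n : R) : Prop :=
  forall l, NoDup l -> (forall x, In x l -> P x) -> INR (length l) <= n.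

Fixpoint list_sum {U : Type} (l : list U) (g : U -> R) : R :=
  match l with nil => 0 | u :: l' => g u + list_sum l' g end.

Lemma at_most_impl {T} (P Q : T -> Prop) n :
  (forall x, P x -> Q x) -> at_most Q n -> at_most P n.
Proof. intros H HQ l Hl Hin. apply HQ; auto. Qed.

Lemma at_most_le {T} (P : T -> Prop) m n : m <= n -> at_most P m -> at_most P n.
Proof. intros H HP l Hl Hin. apply Rle_trans with m; auto. Qed.

(** [at_most] speaks of repetition-free lists, so an empty set meets every bound [0 <= n]. A bound
    may therefore be proved from a member, which is how inequalities between the parameters of a box
    are read off a solution in it. *)
Lemma at_most_inhabited {T} (P : T -> Prop) n :
  0 <= n -> (forall x, P x -> at_most P n) -> at_most P n.
Proof.
  intros Hn H [|x l] Hl Hin; simpl; [exact Hn|].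
  apply (H x (Hin x (or_introl eq_refl)) (x :: l) Hl Hin).
Qed.

Lemma at_most_one {T} (P : T -> Prop) :
  (forall x y, P x -> P y -> x = y) -> at_most P 1.
Proof.
  intros H [|x [|y l]] Hl Hin; simpl; try lra.
  exfalso. inversion Hl as [|? ? Hx]; subst. apply Hx. left.
  apply H; apply Hin; simpl; auto.
Qed.

Lemma at_most_two {T} (P : T -> Prop) :
  (forall x y z, P x -> P y -> P z -> x = y \/ y = z \/ x = z) -> at_most P 2.
Proof.
  intros H [|x [|y [|z l]]] Hl Hin; simpl; try lra.
  exfalso. inversion Hl as [|? ? Hx Hl']; subst. inversion Hl' as [|? ? Hy Hl'']; subst.
  simpl in *.
  destruct (H x y z) as [E|[E|E]]; auto; subst; auto.
Qed.

Lemma at_most_inj {T U} (P : T -> Prop) (Q : U -> Prop) (f : T -> U) n :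
  (forall x, P x -> Q (f x)) -> (forall x y, P x -> P y -> f x = f y -> x = y) ->
  at_most Q n -> at_most P n.
Proof.
  intros HPQ Hinj HQ l Hl Hin. rewrite <- (length_map f).
  apply HQ.
  - apply NoDup_map_NoDup_ForallPairs; auto.
    intros x y Hx Hy. apply Hinj; auto.
  - intros u Hu. apply in_map_iff in Hu. destruct Hu as [x [<- Hx]]. auto.
Qed.

Lemma at_most_split {T} (P Q : T -> Prop) m n :
  at_most (fun x => P x /\ Q x) m -> at_most (fun x => P x /\ ~ Q x) n ->
  at_most P (m + n).
Proof.
  intros Hm Hn l Hl Hin.
  set (q := fun x => if excluded_middle_informative (Q x) then true else false).
  rewrite <- (filter_length q l), plus_INR. apply Rplus_le_compat.
  - apply Hm; [apply NoDup_filter; auto|].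
    intros x Hx. apply filter_In in Hx. unfold q in Hx.
    destruct excluded_middle_informative; destruct Hx; try discriminate; auto.
  - apply Hn; [apply NoDup_filter; auto|].
    intros x Hx. apply filter_In in Hx. unfold q in Hx.
    destruct excluded_middle_informative; simpl in Hx; destruct Hx; try discriminate; auto.
Qed.

Lemma at_most_or {T} (P Q1 Q2 : T -> Prop) m n :
  (forall x, P x -> Q1 x \/ Q2 x) -> at_most Q1 m -> at_most Q2 n ->
  at_most P (m + n).
Proof.
  intros H H1 H2. apply at_most_split with (Q := Q1).
  - revert H1. apply at_most_impl. tauto.
  - revert H2. apply at_most_impl. intros x [Hx Hn]. destruct (H x Hx); tauto.
Qed.

Lemma at_most_fiber {T U} (P : T -> Prop) (f : T -> U) (lu : list U) (g : U -> R) :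
  (forall x, P x -> In (f x) lu) ->
  (forall u, In u lu -> at_most (fun x => P x /\ f x = u) (g u)) ->
  at_most P (list_sum lu g).
Proof.
  revert P. induction lu as [|u lu IH]; simpl; intros P Hin Hg.
  - intros [|x l] _ Hl; simpl; [lra|]. destruct (Hin x); apply Hl; simpl; auto.
  - apply at_most_split with (Q := fun x => f x = u); [apply Hg; auto|].
    apply IH.
    + intros x [Hx Hne]. destruct (Hin x Hx); try congruence; auto.
    + intros v Hv. generalize (Hg v (or_intror Hv)). apply at_most_impl. tauto.
Qed.

Lemma list_sum_le {U} (l : list U) g h :
  (forall u, In u l -> g u <= h u) -> list_sum l g <= list_sum l h.
Proof.
  induction l as [|u l IH]; simpl; intros H; [lra|].
  apply Rplus_le_compat; [apply H; auto|apply IH; auto].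
Qed.

Lemma list_sum_scal {U} (l : list U) c g :
  list_sum l (fun u => c * g u) = c * list_sum l g.
Proof. induction l as [|u l IH]; simpl; [ring|]. rewrite IH. ring. Qed.

Lemma list_sum_app {U} (l m : list U) g :
  list_sum (l ++ m) g = list_sum l g + list_sum m g.
Proof. induction l as [|u l IH]; simpl; [ring|]. rewrite IH. ring. Qed.

Lemma list_sum_map {U V} (l : list U) (h : U -> V) g :
  list_sum (map h l) g = list_sum l (fun u => g (h u)).
Proof. induction l as [|u l IH]; simpl; [ring|]. rewrite IH. ring. Qed.

Lemma list_sum_seq_S s n g :
  list_sum (seq s (S n)) g = list_sum (seq s n) g + g (s + n)%nat.
Proof. rewrite seq_S, list_sum_app. simpl. ring. Qed.

Lemma list_sum_const {U} (l : list U) c : list_sum l (fun _ => c) = INR (length l) * c.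
Proof.
  induction l as [|u l IH]; [simpl; ring|].
  cbn [list_sum length]. rewrite S_INR, IH. ring.
Qed.

Lemma at_most_fiber_Z {T} (P : T -> Prop) (f : T -> Z) a b c :
  0 <= c -> 0 <= b - a + 1 ->
  (forall x, P x -> a <= IZR (f x) <= b) ->
  (forall n, at_most (fun x => P x /\ f x = n) c) ->
  at_most P ((b - a + 1) * c).
Proof.
  intros Hc Hab Hf Hn.
  (* [up r - 1] is the floor of [r], so [lo] is the ceiling of [a] and [hi] the floor of [b]. *)
  set (lo := (- (up (- a) - 1))%Z). set (hi := (up b - 1)%Z).
  assert (Hlo : a <= IZR lo).
  { unfold lo. rewrite opp_IZR, minus_IZR. destruct (archimed (- a)). lra. }
  assert (Hhi : IZR hi <= b).
  { unfold hi. rewrite minus_IZR. destruct (archimed b). lra. }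
  apply at_most_le with
    (list_sum (map (fun k => (lo + Z.of_nat k)%Z) (seq 0 (Z.to_nat (hi - lo + 1)))) (fun _ => c)).
  - rewrite list_sum_const, length_map, length_seq.
    apply Rmult_le_compat_r; auto.
    rewrite INR_IZR_INZ. destruct (Z_le_gt_dec 0 (hi - lo + 1)).
    + rewrite Z2Nat.id by auto. rewrite plus_IZR, minus_IZR. lra.
    + replace (Z.to_nat (hi - lo + 1)) with 0%nat by lia.
      simpl. lra.
  - apply at_most_fiber with (f := f); [|auto].
    intros x Hx. specialize (Hf x Hx). apply in_map_iff.
    assert (Hl1 : (lo <= f x)%Z).
    { apply Z.lt_pred_le. apply lt_IZR. unfold Z.pred. rewrite plus_IZR.
      unfold lo. rewrite opp_IZR, minus_IZR. destruct (archimed (- a)). lra. }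
    assert (Hl2 : (f x <= hi)%Z).
    { apply Zlt_succ_le. apply lt_IZR. unfold Z.succ. rewrite plus_IZR.
      unfold hi. rewrite minus_IZR. destruct (archimed b). lra. }
    exists (Z.to_nat (f x - lo)). split; [lia|]. apply in_seq. lia.
Qed.

(** The partial sum in question stops at the floor of [N]. The case [m = 0] is listed apart because
    [N] may be negative, and then there are no values to sum over. *)
Lemma at_most_fiber_pos_Z {T} (P : T -> Prop) (f : T -> Z) N (g : R -> R) S :
  (forall x, P x -> 1 <= IZR (f x) <= N) ->
  (forall n, (1 <= n)%Z -> at_most (fun x => P x /\ f x = n) (g (IZR n))) ->
  (forall m, (m = 0%nat \/ INR m <= N) -> list_sum (seq 1 m) (fun k => g (INR k)) <= S) ->
  at_most P S.
Proof.
  intros Hf Hn HS.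
  set (m := Z.to_nat (up N - 1)).
  apply at_most_le with (list_sum (map Z.of_nat (seq 1 m)) (fun n => g (IZR n))).
  - rewrite list_sum_map.
    eapply Rle_trans; [|apply (HS m)].
    + apply list_sum_le. intros u _. rewrite <- INR_IZR_INZ. lra.
    + unfold m. rewrite INR_IZR_INZ. destruct (Z_le_gt_dec 0 (up N - 1)).
      * right. rewrite Z2Nat.id by auto. rewrite minus_IZR. destruct (archimed N). lra.
      * left. lia.
  - apply at_most_fiber with (f := f).
    + intros x Hx. specialize (Hf x Hx). apply in_map_iff.
      assert (1 <= f x)%Z by (apply le_IZR; lra).
      assert (f x <= up N - 1)%Z.
      { apply Zlt_succ_le. apply lt_IZR. unfold Z.succ. rewrite plus_IZR, minus_IZR.
        destruct (archimed N). lra. }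
      exists (Z.to_nat (f x)). split; [lia|]. apply in_seq. unfold m. lia.
    + intros u Hu. apply Hn. apply in_map_iff in Hu.
      destruct Hu as [k [<- Hk]]. apply in_seq in Hk. lia.
Qed.

(** * Harmonic, zeta, geometric and logarithmic sums over fibers *)

Lemma inv_succ_le_ln x : 0 < x -> / (x + 1) <= ln (x + 1) - ln x.
Proof.
  intros Hx.
  assert (H : ln (x / (x + 1)) <= x / (x + 1) - 1).
  { assert (Hp : 0 < x / (x + 1)) by (apply Rdiv_lt_0_compat; lra).
    rewrite <- (ln_exp (x / (x + 1) - 1)).
    destruct (Req_dec (x / (x + 1) - 1) 0) as [E|E].
    - rewrite E, exp_0. replace (x / (x + 1)) with 1 by lra. lra.
    - left. apply ln_increasing; auto.
      generalize (exp_ineq1 _ E). lra. }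
  unfold Rdiv in H at 1. rewrite ln_mult, ln_Rinv in H by (try apply Rinv_0_lt_compat; lra).
  replace (x / (x + 1) - 1) with (- / (x + 1)) in H by (field; lra). lra.
Qed.

Lemma ln_nonneg x : 1 <= x -> 0 <= ln x.
Proof.
  intros [H|<-]; [|rewrite ln_1; lra]. rewrite <- ln_1. left. apply ln_increasing; lra.
Qed.

Lemma harmonic_sum_le m : (1 <= m)%nat -> list_sum (seq 1 m) (fun k => / INR k) <= 1 + ln (INR m).
Proof.
  induction m as [|[|m] IH]; [lia| |].
  - intros _. simpl. rewrite ln_1. lra.
  - intros _. rewrite list_sum_seq_S. specialize (IH ltac:(lia)).
    change (1 + S m)%nat with (S (S m)).
    assert (Hp : 0 < INR (S m)) by (apply lt_0_INR; lia).
    generalize (inv_succ_le_ln _ Hp). rewrite (S_INR (S m)). lra.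
Qed.

Lemma at_most_fiber_harmonic {T} (P : T -> Prop) (f : T -> Z) N c :
  0 <= c -> 1 <= N ->
  (forall x, P x -> 1 <= IZR (f x) <= N) ->
  (forall n, (1 <= n)%Z -> at_most (fun x => P x /\ f x = n) (c * / IZR n)) ->
  at_most P (c * (1 + ln N)).
Proof.
  intros Hc HN Hf Hn.
  apply at_most_fiber_pos_Z with (f := f) (N := N) (g := fun x => c * / x); auto.
  assert (Hl := ln_nonneg N HN).
  intros m Hm. rewrite list_sum_scal. apply Rmult_le_compat_l; auto.
  destruct m as [|m]; [simpl; lra|].
  eapply Rle_trans; [apply harmonic_sum_le; lia|].
  destruct Hm as [Hm|Hm]; [lia|].
  assert (0 < INR (S m)) by (apply lt_0_INR; lia).
  destruct Hm as [Hm| ->]; [|lra].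
  assert (ln (INR (S m)) < ln N) by (apply ln_increasing; auto). lra.
Qed.

Definition cbrt (x : R) : R := Rpower x (/ 3).

Lemma cbrt_pos x : 0 < cbrt x.
Proof. apply exp_pos. Qed.

Lemma cbrt_cube x : 0 < x -> x = cbrt x ^ 3.
Proof.
  intros Hx. unfold cbrt. rewrite <- (Rpower_pow 3) by apply exp_pos.
  rewrite Rpower_mult. replace (/ 3 * INR 3) with 1 by (simpl; field).
  rewrite Rpower_1; auto.
Qed.

Lemma cbrt_le_id x : 1 <= x -> cbrt x <= x.
Proof.
  intros Hx. rewrite <- (Rpower_1 x) at 2 by lra. apply Rle_Rpower; lra.
Qed.

(** [3 / m^(1/3)] is the integral of [x^(-4/3)] from [m] to infinity, so the sum telescopes against
    it; dropping it bounds every partial sum by 4. *)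
Lemma zeta_four_thirds_sum_le m :
  (1 <= m)%nat ->
  list_sum (seq 1 m) (fun k => / (INR k * cbrt (INR k))) <= 4 - 3 / cbrt (INR m).
Proof.
  induction m as [|[|m] IH]; [lia| |].
  - intros _. simpl. unfold cbrt, Rpower. rewrite ln_1, Rmult_0_r, exp_0. lra.
  - intros _. rewrite list_sum_seq_S. specialize (IH ltac:(lia)).
    change (1 + S m)%nat with (S (S m)).
    assert (Hp : 0 < INR (S m)) by (apply lt_0_INR; lia).
    assert (Hq : 0 < INR (S (S m))) by (apply lt_0_INR; lia).
    assert (HS : INR (S (S m)) = INR (S m) + 1) by apply S_INR.
    set (x := INR (S m)) in *. set (z := INR (S (S m))) in *.
    assert (Ha := cbrt_cube x Hp). assert (Hb := cbrt_cube z Hq).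
    assert (Ha0 : 0 < cbrt x) by apply cbrt_pos.
    assert (Hb0 : 0 < cbrt z) by apply cbrt_pos.
    set (a := cbrt x) in *. set (b := cbrt z) in *.
    assert (Hab : a < b).
    { destruct (Rlt_le_dec a b) as [H|H]; auto. exfalso.
      assert (b ^ 3 <= a ^ 3) by (apply pow_incr; lra). lra. }
    assert (E : 3 / a - 3 / b - / (z * b) = (3 * (b - a) * b ^ 3 - a) / (a * (b ^ 3 * b))).
    { rewrite Hb. field. lra. }
    enough (0 <= 3 / a - 3 / b - / (z * b)) by lra.
    rewrite E. apply Rmult_le_pos.
    (* Here [b^3 - a^3 = 1] and [a < b], so the factor [b^2 + a b + a^2] may be enlarged to
       [3 b^2]. *)
    + assert (H3 : (b - a) * (b * b + a * b + a * a) = 1).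
      { replace 1 with (b ^ 3 - a ^ 3) by lra. ring. }
      assert (H4 : 1 <= (b - a) * (3 * (b * b))).
      { rewrite <- H3. apply Rmult_le_compat_l; nra. }
      assert (b * 1 <= b * ((b - a) * (3 * (b * b)))) by (apply Rmult_le_compat_l; lra).
      simpl. lra.
    + left. apply Rinv_0_lt_compat. apply Rmult_lt_0_compat; auto.
      apply Rmult_lt_0_compat; auto. apply pow_lt; auto.
Qed.

Lemma at_most_fiber_zeta {T} (P : T -> Prop) (f : T -> Z) N c :
  0 <= c ->
  (forall x, P x -> 1 <= IZR (f x) <= N) ->
  (forall n, (1 <= n)%Z ->
     at_most (fun x => P x /\ f x = n) (c * / (IZR n * cbrt (IZR n)))) ->
  at_most P (c * 4).
Proof.
  intros Hc Hf Hn.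
  apply at_most_fiber_pos_Z with (f := f) (N := N) (g := fun x => c * / (x * cbrt x)); auto.
  intros m _. rewrite list_sum_scal. apply Rmult_le_compat_l; auto.
  destruct m as [|m]; [simpl; lra|].
  eapply Rle_trans; [apply zeta_four_thirds_sum_le; lia|].
  assert (0 < 3 / cbrt (INR (S m))) by (apply Rdiv_lt_0_compat; [lra|apply exp_pos]).
  lra.
Qed.

Lemma geometric_sum_le b n :
  2 <= b -> list_sum (seq 0 (S n)) (fun k => b ^ k) <= 2 * b ^ n.
Proof.
  intros Hb. induction n as [|n IH]; [simpl; lra|].
  rewrite list_sum_seq_S. change (0 + S n)%nat with (S n).
  assert (0 < b ^ n) by (apply pow_lt; lra).
  simpl pow in *. nra.
Qed.

Lemma max_fiber {T} (f : T -> nat) (l : list T) :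
  l <> nil -> exists x, In x l /\ forall y, In y l -> (f y <= f x)%nat.
Proof.
  induction l as [|a [|b l] IH]; intros H; [congruence| |].
  - exists a. simpl. intuition (subst; auto).
  - destruct IH as [x [Hx Hm]]; [congruence|].
    destruct (Nat.le_gt_cases (f a) (f x)).
    + exists x. split; [right; auto|]. intros y [<-|Hy]; auto.
    + exists a. split; [left; auto|]. intros y [<-|Hy]; auto.
      specialize (Hm y Hy). lia.
Qed.

(** A geometric sum is at most twice its last term. The largest exponent is taken from the list
    being counted, so [Q] can be any nonnegative real that dominates the powers, in particular a
    quotient depending on the variables already fixed. *)
Lemma at_most_fiber_geom {T} (P : T -> Prop) (f : T -> nat) b Q c :
  2 <= b -> 0 <= c -> 0 <= Q ->
  (forall x, P x -> b ^ f x <= Q) ->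
  (forall n, at_most (fun x => P x /\ f x = n) (c * b ^ n)) ->
  at_most P (c * (2 * Q)).
Proof.
  intros Hb Hc HQ Hf Hn l Hl Hin.
  destruct (excluded_middle_informative (l = nil)) as [->|Hne].
  { simpl. apply Rmult_le_pos; lra. }
  destruct (max_fiber f l Hne) as [x [Hx Hm]].
  assert (HL : at_most (fun y => In y l) (list_sum (seq 0 (S (f x))) (fun k => c * b ^ k))).
  { apply at_most_fiber with (f := f).
    - intros y Hy. apply in_seq. specialize (Hm y Hy). lia.
    - intros u _. generalize (Hn u). apply at_most_impl. intuition. }
  eapply Rle_trans; [apply (HL l Hl); auto|].
  rewrite (list_sum_scal _ c (fun k => b ^ k)). apply Rmult_le_compat_l; auto.
  eapply Rle_trans; [apply geometric_sum_le; auto|]. specialize (Hf x (Hin x Hx)). lra.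
Qed.

Lemma at_most_fiber_log {T} (P : T -> Prop) (f : T -> nat) N c :
  0 <= c -> 1 <= N ->
  (forall x, P x -> 4 ^ f x <= N) ->
  (forall n, at_most (fun x => P x /\ f x = n) c) ->
  at_most P ((1 + ln N) * c).
Proof.
  intros Hc HN Hf Hn.
  (* Since [ln 4 > 1], the exponents lie between 0 and [ln N]. *)
  assert (H4 : 1 < ln 4).
  { replace 4 with (2 * 2) by ring. rewrite ln_mult by lra. generalize ln_lt_2. lra. }
  assert (HlN := ln_nonneg N HN).
  replace (1 + ln N) with (ln N - 0 + 1) by ring.
  apply at_most_fiber_Z with (f := fun x => Z.of_nat (f x)); [lra|lra| |].
  - intros x Hx. rewrite <- INR_IZR_INZ. split; [apply pos_INR|].
    assert (ln (4 ^ f x) <= ln N).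
    { destruct (Hf x Hx) as [H|H]; [left; apply ln_increasing; auto; apply pow_lt; lra|rewrite H; lra]. }
    rewrite ln_pow in H by lra. assert (0 <= INR (f x)) by apply pos_INR. nra.
  - intros n. generalize (Hn (Z.to_nat n)). apply at_most_impl. intros x [Hx <-].
    rewrite Nat2Z.id. auto.
Qed.

Lemma at_most_fiber_bounded {T} (P : T -> Prop) (f : T -> nat) k c :
  0 <= c ->
  (forall x y, P x -> P y -> (f x <= f y + k)%nat) ->
  (forall n, at_most (fun x => P x /\ f x = n) c) ->
  at_most P ((2 * INR k + 1) * c).
Proof.
  intros Hc Hf Hn. assert (Hk := pos_INR k).
  apply at_most_inhabited; [apply Rmult_le_pos; lra|]. intros x0 H0.
  replace (2 * INR k + 1) with ((INR (f x0) + INR k) - (INR (f x0) - INR k) + 1) by ring.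
  apply at_most_fiber_Z with (f := fun x => Z.of_nat (f x)); [lra|lra| |].
  - intros x Hx. rewrite <- INR_IZR_INZ.
    assert (H1 := le_INR _ _ (Hf x x0 Hx H0)). assert (H2 := le_INR _ _ (Hf x0 x H0 Hx)).
    rewrite plus_INR in *. lra.
  - intros n. generalize (Hn (Z.to_nat n)). apply at_most_impl. intros x [Hx <-].
    rewrite Nat2Z.id. auto.
Qed.

(** * Solutions with fixed y *)

(** [pd] and [pt] are the [d] and [t] of the overview. In [on_conic] the [si] and [yi] are positive,
    so the [Ai] carry all signs. *)
Record param := Param {
  pd : Z; pt : Z; s1 : Z; s2 : Z; s3 : Z;
  y1 : Z; y2 : Z; y3 : Z; A1 : Z; A2 : Z; A3 : Z }.

Record on_conic (p : param) : Prop := {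
  s1_pos : (0 < s1 p)%Z; s2_pos : (0 < s2 p)%Z; s3_pos : (0 < s3 p)%Z;
  y1_pos : (0 < y1 p)%Z; y2_pos : (0 < y2 p)%Z; y3_pos : (0 < y3 p)%Z;
  A1_neq0 : A1 p <> 0%Z; A2_neq0 : A2 p <> 0%Z; A3_neq0 : A3 p <> 0%Z;
  conic_eq : (s1 p * A1 p * y1 p ^ 2 + s2 p * A2 p * y2 p ^ 2 + s3 p * A3 p * y3 p ^ 2 = 0)%Z;
  coprime12 : rel_prime (s1 p * A1 p * y1 p) (s2 p * A2 p * y2 p);
  coprime13 : rel_prime (s1 p * A1 p * y1 p) (s3 p * A3 p * y3 p);
  coprime23 : rel_prime (s2 p * A2 p * y2 p) (s3 p * A3 p * y3 p) }.

(** These are the floors of the logarithms of [|a|] to base 4 and 8, for [a] nonzero. *)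
Definition log4 (a : Z) : nat := Z.to_nat (Z.log2 (Z.abs a) / 2).
Definition log8 (a : Z) : nat := Z.to_nat (Z.log2 (Z.abs a) / 3).

Lemma log4_spec a : a <> 0%Z -> 4 ^ log4 a <= Rabs (IZR a) < 4 * 4 ^ log4 a.
Proof.
  intros Ha. unfold log4.
  assert (H := Z.log2_spec (Z.abs a) ltac:(lia)).
  assert (H0 := Z.log2_nonneg (Z.abs a)).
  set (k := Z.log2 (Z.abs a)) in *.
  assert (Hq : (0 <= k / 2)%Z) by (apply Z.div_pos; lia).
  rewrite <- abs_IZR.
  assert (E : 4 ^ Z.to_nat (k / 2) = IZR (2 ^ (2 * (k / 2)))).
  { rewrite Z.pow_mul_r by lia. rewrite <- (Z2Nat.id (k / 2)) at 2 by lia.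
    rewrite <- pow_IZR. reflexivity. }
  rewrite E. rewrite <- mult_IZR. split.
  - apply IZR_le. apply Z.le_trans with (2 ^ k)%Z; [|lia].
    apply Z.pow_le_mono_r; [lia|]. apply Z.mul_div_le. lia.
  - apply IZR_lt. apply Z.lt_le_trans with (2 ^ Z.succ k)%Z; [lia|].
    replace (4 * 2 ^ (2 * (k / 2)))%Z with (2 ^ (2 * (k / 2) + 2))%Z
      by (rewrite Z.pow_add_r by lia; lia).
    apply Z.pow_le_mono_r; [lia|]. assert (Hm := Z.mul_succ_div_gt k 2). lia.
Qed.

Lemma log8_spec a : (0 < a)%Z -> 8 ^ log8 a <= IZR a < 8 * 8 ^ log8 a.
Proof.
  intros Ha. unfold log8. rewrite Z.abs_eq by lia.
  assert (H := Z.log2_spec a Ha).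
  assert (H0 := Z.log2_nonneg a).
  set (k := Z.log2 a) in *.
  assert (Hq : (0 <= k / 3)%Z) by (apply Z.div_pos; lia).
  assert (E : 8 ^ Z.to_nat (k / 3) = IZR (2 ^ (3 * (k / 3)))).
  { rewrite Z.pow_mul_r by lia. rewrite <- (Z2Nat.id (k / 3)) at 2 by lia.
    rewrite <- pow_IZR. reflexivity. }
  rewrite E. rewrite <- mult_IZR. split.
  - apply IZR_le. apply Z.le_trans with (2 ^ k)%Z; [|lia].
    apply Z.pow_le_mono_r; [lia|]. apply Z.mul_div_le. lia.
  - apply IZR_lt. apply Z.lt_le_trans with (2 ^ Z.succ k)%Z; [lia|].
    replace (8 * 2 ^ (3 * (k / 3)))%Z with (2 ^ (3 * (k / 3) + 3))%Z
      by (rewrite Z.pow_add_r by lia; lia).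
    apply Z.pow_le_mono_r; [lia|]. assert (Hm := Z.mul_succ_div_gt k 3). lia.
Qed.

Lemma rel_prime_dvd a b c d :
  rel_prime a b -> (c | a)%Z -> (d | b)%Z -> rel_prime c d.
Proof.
  intros H Hc Hd. apply rel_prime_div with (p := a); auto.
  apply rel_prime_sym. apply rel_prime_div with (p := b); auto.
  apply rel_prime_sym; auto.
Qed.

Lemma rel_prime_sq a b : rel_prime a b -> rel_prime (a ^ 2) (b ^ 2).
Proof.
  intros H. rewrite !Z.pow_2_r.
  assert (H1 : rel_prime (a * a) b).
  { apply rel_prime_sym. apply rel_prime_mult; apply rel_prime_sym; auto. }
  apply rel_prime_mult; auto.
Qed.

Record in_box (d t c1 c2 c3 : Z) (a1 a2 a3 b1 b2 b3 : nat) (p : param) : Prop := {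
  box_d : pd p = d; box_t : pt p = t;
  box_s1 : s1 p = c1; box_s2 : s2 p = c2; box_s3 : s3 p = c3;
  box_A1 : log4 (A1 p) = a1; box_A2 : log4 (A2 p) = a2; box_A3 : log4 (A3 p) = a3;
  box_y1 : log8 (y1 p) = b1; box_y2 : log8 (y2 p) = b2; box_y3 : log8 (y3 p) = b3 }.

Lemma sgn_range z : -1 <= IZR (Z.sgn z) <= 1.
Proof. destruct z; simpl; lra. Qed.

Lemma up_range v r : Rabs v <= r -> - r <= IZR (up v) <= r + 1.
Proof.
  intros H. destruct (archimed v). generalize (Rle_abs v) (Rle_abs (- v)).
  rewrite Rabs_Ropp. lra.
Qed.

Lemma up_eq_close v w : up v = up w -> Rabs (v - w) < 1.
Proof.
  intros H. destruct (archimed v), (archimed w). rewrite H in *.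
  apply Rabs_def1; lra.
Qed.

(** By Gauss [b] and [b'] divide each other, so they agree up to sign, and the sign is
    prescribed. *)
Lemma proportional_coprime_eq a b a' b' :
  rel_prime a b -> rel_prime a' b' -> (b <> 0)%Z -> Z.sgn b = Z.sgn b' ->
  (a * b' = b * a')%Z -> a = a' /\ b = b'.
Proof.
  intros H H' Hb Hs E.
  assert (D1 : (b | b')%Z).
  { apply Gauss with a; [exists a'; lia|]. apply rel_prime_sym; auto. }
  assert (D2 : (b' | b)%Z).
  { apply Gauss with a'; [exists a; lia|]. apply rel_prime_sym; auto. }
  assert (b = b').
  { destruct (Z.divide_antisym _ _ D1 D2) as [F|F]; auto.
    subst b. destruct b'; simpl in *; lia. }
  subst b'. split; auto. apply Z.mul_reg_r with b; lia.
Qed.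

Lemma dvd_abs_le a b : (a | b)%Z -> b <> 0%Z -> Rabs (IZR a) <= Rabs (IZR b).
Proof.
  intros H Hb. rewrite <- !abs_IZR. apply IZR_le.
  apply Z.divide_pos_le; [lia|]. apply Z.divide_abs_l, Z.divide_abs_r; auto.
Qed.

(* Two distinct solutions [A] for the same [y] (up to sign) have slopes [A2/A3] differing by a nonzero
   multiple of [s1 y1^2 / (A3 A3')]. *)
Lemma lattice_determinant_dvd p q :
  on_conic p -> on_conic q ->
  s1 p = s1 q -> s2 p = s2 q -> s3 p = s3 q -> y1 p = y1 q -> y2 p = y2 q -> y3 p = y3 q ->
  (s1 p * y1 p ^ 2 | A2 p * A3 q - A3 p * A2 q)%Z.
Proof.
  intros Hp Hq E1 E2 E3 F1 F2 F3.
  apply Gauss with (s2 p * y2 p ^ 2)%Z.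
  - exists (A1 q * A3 p - A1 p * A3 q)%Z.
    assert (Gp := conic_eq p Hp). assert (Gq := conic_eq q Hq).
    rewrite <- E1, <- E2, <- E3, <- F1, <- F2, <- F3 in Gq.
    transitivity ((- (s1 p * A1 p * y1 p ^ 2) - s3 p * A3 p * y3 p ^ 2) * A3 q
       + (s1 p * A1 q * y1 p ^ 2 + s3 p * A3 q * y3 p ^ 2) * A3 p)%Z; [|ring].
    replace (- (s1 p * A1 p * y1 p ^ 2) - s3 p * A3 p * y3 p ^ 2)%Z
      with (s2 p * A2 p * y2 p ^ 2)%Z by lia.
    replace (s1 p * A1 q * y1 p ^ 2 + s3 p * A3 q * y3 p ^ 2)%Z
      with (- (s2 p * A2 q * y2 p ^ 2))%Z by lia.
    ring.
  - apply rel_prime_dvd with (1 := rel_prime_sq _ _ (coprime12 p Hp)).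
    + exists (s1 p * A1 p ^ 2)%Z. ring.
    + exists (s2 p * A2 p ^ 2)%Z. ring.
Qed.

(** The determinant [A2 A3' - A3 A2'] is the difference of the slopes times [A3 A3'], so close
    slopes make it smaller than its divisor [s1 y1^2] and hence zero. Then the coprime pairs
    [(A2, A3)] are proportional, thus equal by the sign of [A3], and the conic equation gives
    [A1]. *)
Lemma slope_separation p q M :
  on_conic p -> on_conic q -> pd p = pd q -> pt p = pt q ->
  s1 p = s1 q -> s2 p = s2 q -> s3 p = s3 q -> y1 p = y1 q -> y2 p = y2 q -> y3 p = y3 q ->
  Z.sgn (A3 p) = Z.sgn (A3 q) -> Rabs (IZR (A3 p)) < M -> Rabs (IZR (A3 q)) < M ->
  Rabs (IZR (A2 p) / IZR (A3 p) - IZR (A2 q) / IZR (A3 q)) * (M * M) < IZR (s1 p * y1 p ^ 2) ->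
  p = q.
Proof.
  intros Hp Hq Ed Et E1 E2 E3 F1 F2 F3 Hsgn Mp Mq Hsep.
  assert (Hdvd := lattice_determinant_dvd p q Hp Hq E1 E2 E3 F1 F2 F3).
  assert (Np := A3_neq0 p Hp). assert (Nq := A3_neq0 q Hq).
  assert (Hw : (0 < s1 p * y1 p ^ 2)%Z).
  { apply Z.mul_pos_pos; [apply Hp|]. apply Z.pow_pos_nonneg; [apply Hp|lia]. }
  destruct (Z.eq_dec (A2 p * A3 q - A3 p * A2 q) 0) as [E|E].
  - destruct (proportional_coprime_eq (A2 p) (A3 p) (A2 q) (A3 q)) as [G2 G3]; auto; [| |lia|].
    { apply rel_prime_dvd with (1 := coprime23 p Hp);
        [exists (s2 p * y2 p)%Z|exists (s3 p * y3 p)%Z]; ring. }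
    { apply rel_prime_dvd with (1 := coprime23 q Hq);
        [exists (s2 q * y2 q)%Z|exists (s3 q * y3 q)%Z]; ring. }
    assert (G1 : A1 p = A1 q).
    { assert (Gp := conic_eq p Hp). assert (Gq := conic_eq q Hq).
      apply Z.mul_reg_r with (s1 p * y1 p ^ 2)%Z; [lia|].
      rewrite <- E1, <- E2, <- E3, <- F1, <- F2, <- F3, <- G2, <- G3 in Gq.
      clear - Gp Gq. lia. }
    clear - Ed Et E1 E2 E3 F1 F2 F3 G1 G2 G3.
    destruct p, q; simpl in *; subst; reflexivity.
  - exfalso.
    assert (Hle := dvd_abs_le _ _ Hdvd E).
    rewrite (Rabs_pos_eq (IZR (s1 p * y1 p ^ 2))) in Hle by (apply IZR_le; lia).
    assert (Pp : 0 < Rabs (IZR (A3 p))) by (apply Rabs_pos_lt, not_0_IZR; auto).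
    assert (Pq : 0 < Rabs (IZR (A3 q))) by (apply Rabs_pos_lt, not_0_IZR; auto).
    assert (Ediff : Rabs (IZR (A2 p * A3 q - A3 p * A2 q)) =
      Rabs (IZR (A2 p) / IZR (A3 p) - IZR (A2 q) / IZR (A3 q)) *
      (Rabs (IZR (A3 p)) * Rabs (IZR (A3 q)))).
    { rewrite <- !Rabs_mult. f_equal. rewrite minus_IZR, !mult_IZR. field.
      split; apply not_0_IZR; auto. }
    rewrite Ediff in Hle.
    assert (Rabs (IZR (A3 p)) * Rabs (IZR (A3 q)) <= M * M).
    { apply Rmult_le_compat; lra. }
    assert (H0 := Rabs_pos (IZR (A2 p) / IZR (A3 p) - IZR (A2 q) / IZR (A3 q))).
    assert (Hmono := Rmult_le_compat_l _ _ _ H0 H). lra.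
Qed.

(** For fixed [y] and fixed sign of [A3] the slopes [A2/A3] fill an interval of length
    [O(4^a2 / 4^a3)] with gaps of at least [s1 y1^2 / (4 * 4^a3)^2]. The fraction in the bound is
    [X / Z1] with [4^a1] cancelled. The constant is [8^3 * 3 * 128]: three ranges for the [yi],
    three values of the sign, and at most [128 (1 + r)] cells. *)
Lemma at_most_linear_box d t c1 c2 c3 a1 a2 a3 b1 b2 b3 :
  (0 < c1)%Z ->
  at_most (fun p => on_conic p /\ in_box d t c1 c2 c3 a1 a2 a3 b1 b2 b3 p)
    (196608 * (8 ^ b1 * 8 ^ b2 * 8 ^ b3) * (1 + 4 ^ a2 * 4 ^ a3 / (IZR c1 * 64 ^ b1))).
Proof.
  intros Hc1.
  assert (Hc1' : 0 < IZR c1) by (apply IZR_lt; auto).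
  assert (P4 : forall n, 0 < 4 ^ n) by (intros; apply pow_lt; lra).
  assert (P8 : forall n, 0 < 8 ^ n) by (intros; apply pow_lt; lra).
  assert (P8' : forall n, 1 <= 8 ^ n) by (intros; apply pow_R1_Rle; lra).
  assert (P64 : forall n, 0 < 64 ^ n) by (intros; apply pow_lt; lra).
  set (r := 4 ^ a2 * 4 ^ a3 / (IZR c1 * 64 ^ b1)).
  assert (Hr : 0 < r).
  { unfold r. apply Rdiv_lt_0_compat; apply Rmult_lt_0_compat; auto. }
  assert (Hbox : forall b (f : param -> Z) (P : param -> Prop) c, 0 <= c ->
    (forall p, P p -> (0 < f p)%Z /\ log8 (f p) = b) ->
    (forall n, at_most (fun p => P p /\ f p = n) c) -> at_most P (8 * 8 ^ b * c)).
  { intros b f P c Hc Hf Hn.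
    apply at_most_le with ((8 * 8 ^ b - 8 ^ b + 1) * c).
    - apply Rmult_le_compat_r; auto. generalize (P8' b). lra.
    - apply at_most_fiber_Z with (f := f); auto; [generalize (P8 b); lra|].
      intros p Hp. destruct (Hf p Hp) as [H0 <-]. destruct (log8_spec _ H0). lra. }
  replace (196608 * (8 ^ b1 * 8 ^ b2 * 8 ^ b3) * (1 + r)) with
    (8 * 8 ^ b1 * (8 * 8 ^ b2 * (8 * 8 ^ b3 * (3 * (128 * (1 + r)))))) by ring.
  assert (Q1 : 0 <= 3 * (128 * (1 + r))) by lra.
  assert (Q2 : 0 <= 8 * 8 ^ b3 * (3 * (128 * (1 + r)))).
  { apply Rmult_le_pos; auto. generalize (P8 b3). lra. }
  apply Hbox with (f := y1).
  { apply Rmult_le_pos; auto. generalize (P8 b2). lra. }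
  { intros p [Hp Hb]. split; [apply Hp|apply Hb]. }
  intros n1. apply Hbox with (f := y2); auto.
  { intros p [[Hp Hb] _]. split; [apply Hp|apply Hb]. }
  intros n2. apply Hbox with (f := y3); auto.
  { intros p [[[Hp Hb] _] _]. split; [apply Hp|apply Hb]. }
  intros n3.
  replace (3 * (128 * (1 + r))) with ((1 - -1 + 1) * (128 * (1 + r))) by ring.
  apply at_most_fiber_Z with (f := fun p => Z.sgn (A3 p)); try lra.
  { intros p _. apply sgn_range. }
  intros sg.
  set (w := IZR c1 * IZR n1 ^ 2).
  apply at_most_inhabited; [lra|]. intros p0 [[[[[Hp0 Hb0] Hy1] Hy2] Hy3] _].
  assert (Hw : IZR c1 * 64 ^ b1 <= w).
  { unfold w. apply Rmult_le_compat_l; [lra|].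
    replace 64 with (8 ^ 2) by ring. rewrite <- pow_mult, Nat.mul_comm, pow_mult.
    apply pow_incr. split; [left; auto|].
    rewrite <- Hy1, <- (box_y1 _ _ _ _ _ _ _ _ _ _ _ _ Hb0). apply log8_spec, Hp0. }
  assert (Hw0 : 0 < w).
  { eapply Rlt_le_trans; [|apply Hw]. apply Rmult_lt_0_compat; auto. }
  clear p0 Hp0 Hb0 Hy1 Hy2 Hy3.
  (* [1 / k] is the guaranteed gap between slopes, so [up] of [k] times the slope separates the
     solutions. *)
  set (k := 16 * (4 ^ a3 * 4 ^ a3) / w).
  assert (Hk : 0 < k).
  { unfold k. apply Rdiv_lt_0_compat; auto.
    assert (0 < 4 ^ a3 * 4 ^ a3) by (apply Rmult_lt_0_compat; auto). lra. }
  apply at_most_le with ((64 * r + 1 - - (64 * r) + 1) * 1); [lra|].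
  apply at_most_fiber_Z with (f := fun p => up (k * (IZR (A2 p) / IZR (A3 p)))); try lra.
  - intros p [[[[[Hp Hb] Hy1] Hy2] Hy3] Hs]. apply up_range.
    destruct (log4_spec _ (A2_neq0 p Hp)) as [_ B2].
    destruct (log4_spec _ (A3_neq0 p Hp)) as [B3 _].
    rewrite (box_A2 _ _ _ _ _ _ _ _ _ _ _ _ Hb) in B2.
    rewrite (box_A3 _ _ _ _ _ _ _ _ _ _ _ _ Hb) in B3.
    rewrite Rabs_mult, (Rabs_pos_eq k) by lra.
    unfold Rdiv. rewrite Rabs_mult, Rabs_inv.
    assert (J : Rabs (IZR (A2 p)) * / Rabs (IZR (A3 p)) <= 4 * 4 ^ a2 / 4 ^ a3).
    { unfold Rdiv. apply Rmult_le_compat; [apply Rabs_pos| |lra|].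
      - left. apply Rinv_0_lt_compat. generalize (P4 a3). lra.
      - apply Rinv_le_contravar; auto. }
    apply Rle_trans with (k * (4 * 4 ^ a2 / 4 ^ a3)); [apply Rmult_le_compat_l; lra|].
    unfold k, r.
    replace (16 * (4 ^ a3 * 4 ^ a3) / w * (4 * 4 ^ a2 / 4 ^ a3)) with
      (64 * (4 ^ a2 * 4 ^ a3 / w)) by (field; split; apply Rgt_not_eq; apply Rlt_gt; auto).
    apply Rmult_le_compat_l; [lra|]. unfold Rdiv. apply Rmult_le_compat_l.
    + left. apply Rmult_lt_0_compat; auto.
    + apply Rinv_le_contravar; auto. apply Rmult_lt_0_compat; auto.
  - intros m. apply at_most_one.
    intros p q [[[[[[Hp Hb] Hy1] Hy2] Hy3] Hs] Hm] [[[[[[Hp' Hb'] Hy1'] Hy2'] Hy3'] Hs'] Hm'].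
    assert (Hcl := up_eq_close _ _ (eq_trans Hm (eq_sym Hm'))).
    destruct (log4_spec _ (A3_neq0 p Hp)) as [_ B3].
    destruct (log4_spec _ (A3_neq0 q Hp')) as [_ B3'].
    destruct Hb as [? ? Es1 ? ? ? ? Ea3 ? ? ?], Hb' as [? ? ? ? ? ? ? Ea3' ? ? ?].
    rewrite Ea3 in B3. rewrite Ea3' in B3'.
    apply slope_separation with (M := 4 * 4 ^ a3); auto; try congruence.
    rewrite <- Rmult_minus_distr_l, Rabs_mult, (Rabs_pos_eq k) in Hcl by lra.
    replace (IZR (s1 p * y1 p ^ 2)) with w.
    2:{ unfold w. rewrite Es1, Hy1, mult_IZR, Z.pow_2_r, mult_IZR. ring. }
    replace (4 * 4 ^ a3 * (4 * 4 ^ a3)) with (k * w) by (unfold k; field; lra).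
    apply (Rmult_lt_compat_r w) in Hcl; auto. lra.
Qed.

(** * Solutions with fixed coefficients *)

(** This is the average of the divisor function. For a divisor [n <= M] there are at most
    [2 M / n + 1 <= 3 M / n] multiples of [n] in [[-M, M]], and the sum over [n] is harmonic. A pair
    [(f, g)] thus costs only a logarithm more than [f] alone. *)
Lemma at_most_fiber_divisor {T} (P : T -> Prop) (f g : T -> Z) M N c :
  0 <= c -> 1 <= M <= N ->
  (forall x, P x -> (0 < g x)%Z /\ (g x | f x)%Z /\ f x <> 0%Z /\ Rabs (IZR (f x)) <= M) ->
  (forall m n, at_most (fun x => P x /\ g x = n /\ f x = m) c) ->
  at_most P (3 * M * (1 + ln N) * c).
Proof.
  intros Hc HM Hf Hmn.
  assert (Hg : forall x, P x -> 1 <= IZR (g x) <= M).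
  { intros x Hx. destruct (Hf x Hx) as (H0 & H1 & H2 & H3). split; [apply IZR_le; lia|].
    apply Rle_trans with (2 := H3). rewrite <- abs_IZR. apply IZR_le.
    apply Z.divide_pos_le; [lia|]. apply Z.divide_abs_r; auto. }
  replace (3 * M * (1 + ln N) * c) with (3 * M * c * (1 + ln N)) by ring.
  apply at_most_fiber_harmonic with (f := g); [nra|lra| |].
  { intros x Hx. generalize (Hg x Hx). lra. }
  intros n Hn. assert (Hn' : 1 <= IZR n) by (apply IZR_le; auto).
  assert (Hni : 0 < / IZR n) by (apply Rinv_0_lt_compat; lra).
  apply at_most_inhabited; [apply Rmult_le_pos; nra|]. intros x0 [Hx0 <-].
  set (n := g x0) in *.
  assert (HnM : IZR n <= M) by apply (Hg x0 Hx0).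
  assert (Hq : 1 <= M * / IZR n).
  { apply Rmult_le_reg_r with (IZR n); [lra|]. rewrite Rmult_assoc, Rinv_l by lra. lra. }
  apply at_most_le with ((M * / IZR n - - (M * / IZR n) + 1) * c); [nra|].
  apply at_most_fiber_Z with (f := fun x => (f x / n)%Z); try lra.
  - intros x [Hx Hgx]. destruct (Hf x Hx) as (H0 & [h Hh] & H2 & H3).
    rewrite Hgx in Hh. rewrite Hh, Z.div_mul by lia.
    rewrite Hh, mult_IZR, Rabs_mult, (Rabs_pos_eq (IZR n)) in H3 by lra.
    assert (Rabs (IZR h) <= M * / IZR n).
    { apply Rmult_le_reg_r with (IZR n); [lra|]. rewrite Rmult_assoc, Rinv_l by lra. lra. }
    generalize (Rle_abs (IZR h)) (Rle_abs (- IZR h)). rewrite Rabs_Ropp. lra.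
  - intros h. generalize (Hmn (h * n)%Z n). apply at_most_impl.
    intros x [[Hx Hgx] Hh]. repeat split; auto.
    destruct (Hf x Hx) as (H0 & [k Hk] & _). rewrite Hgx in Hk.
    rewrite Hk, Z.div_mul in Hh by lia. congruence.
Qed.

(** Write the gcd as [u g + v h]; both [u g m] and [v h m] are multiples of [g h]. *)
Lemma mul_dvd_gcd_mul g h m : (g | m)%Z -> (h | m)%Z -> (g * h | Z.gcd g h * m)%Z.
Proof.
  intros [x Hx] [y Hy].
  destruct (Z.gcd_bezout g h _ eq_refl) as [u [v E]].
  rewrite <- E. exists (u * y + v * x)%Z.
  transitivity (u * g * m + v * h * m)%Z; [ring|]. rewrite Hy at 1. rewrite Hx at 1. ring.
Qed.

(* Modulo [A] the ratio [a : b] of a solution is a square root of a fixed residue; the gcd with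
   the reference solution [(a0, b0)] records which root it is, up to a factor 2. *)
Lemma minor_dvd A c2 c3 a b a' b' a0 b0 :
  A <> 0%Z ->
  (A | c2 * a ^ 2 + c3 * b ^ 2)%Z -> (A | c2 * a' ^ 2 + c3 * b' ^ 2)%Z ->
  (A | c2 * a0 ^ 2 + c3 * b0 ^ 2)%Z ->
  rel_prime A c2 -> rel_prime A a -> rel_prime A b0 ->
  Z.gcd A (a * b0 - b * a0) = Z.gcd A (a' * b0 - b' * a0) ->
  (A | 2 * (a * b' - b * a'))%Z.
Proof.
  intros HA D D' D0 Rc Ra Rb0 Hg.
  (* Eliminating [c3] between the congruences of a solution and of the reference leaves [c2] times a
     difference of squares. Its two factors express that the ratio is the root of the reference or
     the opposite one. *)
  assert (UV : forall x y, (A | c2 * x ^ 2 + c3 * y ^ 2)%Z ->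
    (A | (x * b0 - y * a0) * (x * b0 + y * a0))%Z).
  { intros x y [k Hk]. destruct D0 as [k0 Hk0]. apply Gauss with c2; auto.
    exists (k * b0 ^ 2 - k0 * y ^ 2)%Z.
    transitivity ((k * A) * b0 ^ 2 - (k0 * A) * y ^ 2)%Z; [|ring].
    rewrite <- Hk, <- Hk0. ring. }
  set (g := Z.gcd A (a * b0 - b * a0)) in *.
  assert (Hg0 : (0 < g)%Z).
  { assert (g <> 0%Z) by (unfold g; intros E; apply Z.gcd_eq_0_l in E; auto).
    assert (0 <= g)%Z by apply Z.gcd_nonneg. lia. }
  destruct (Z.gcd_divide_l A (a * b0 - b * a0)) as [h Hh]. fold g in Hh.
  (* [A] splits as [h g]: modulo [g] the root is that of the reference, modulo the cofactor [h] it
     is the opposite one. Two solutions with the same [g] therefore agree modulo [g] and modulo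
     [h]. *)
  assert (HV : forall x y, Z.gcd A (x * b0 - y * a0) = g -> (A | c2 * x ^ 2 + c3 * y ^ 2)%Z ->
    (g | x * b0 - y * a0)%Z /\ (h | x * b0 + y * a0)%Z).
  { intros x y Hxy Hd. assert (Hgd := Z.gcd_divide_r A (x * b0 - y * a0)). rewrite Hxy in Hgd.
    split; auto. destruct Hgd as [u Hu].
    apply Gauss with u.
    - destruct (UV x y Hd) as [k Hk]. exists k. apply Z.mul_reg_r with g; [lia|].
      rewrite Hu in Hk. rewrite Hh in Hk at 1. clear - Hk. lia.
    - apply Zgcd_1_rel_prime. replace h with (A / g)%Z by (rewrite Hh; apply Z.div_mul; lia).
      replace u with ((x * b0 - y * a0) / g)%Z by (rewrite Hu; apply Z.div_mul; lia).
      apply Z.gcd_div_gcd; [clear - Hg0; lia|auto]. }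
  destruct (HV a b eq_refl D) as [Hg1 Hh1].
  destruct (HV a' b' (eq_sym Hg) D') as [Hg2 Hh2].
  assert (HgA : (g | A)%Z) by (exists h; auto).
  assert (HhA : (h | A)%Z) by (exists g; lia).
  assert (Mg : (g | a * b' - b * a')%Z).
  { apply Gauss with b0.
    - destruct Hg1 as [k Hk], Hg2 as [k' Hk']. exists (k * b' - k' * b)%Z.
      transitivity ((k * g) * b' - (k' * g) * b)%Z; [|ring].
      rewrite <- Hk, <- Hk'. ring.
    - apply rel_prime_div with (2 := HgA); auto. }
  assert (Mh : (h | a * b' - b * a')%Z).
  { apply Gauss with b0.
    - destruct Hh1 as [k Hk], Hh2 as [k' Hk']. exists (k * b' - k' * b)%Z.
      transitivity ((k * h) * b' - (k' * h) * b)%Z; [|ring].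
      rewrite <- Hk, <- Hk'. ring.
    - apply rel_prime_div with (2 := HhA); auto. }
  rewrite Hh at 1. rewrite (Z.mul_comm h g).
  apply Z.divide_trans with (1 := mul_dvd_gcd_mul _ _ _ Mg Mh).
  apply Z.mul_divide_mono_r.
  (* [e] divides both [a b0 - b a0] and [a b0 + b a0], hence [2 a b0]; being a divisor of [A] it is
     coprime to [a b0], so it divides 2. This is the source of the factor 2 in the conclusion. *)
  set (e := Z.gcd g h).
  assert (He1 : (e | g)%Z) by apply Z.gcd_divide_l.
  assert (He2 : (e | h)%Z) by apply Z.gcd_divide_r.
  assert (HeA : (e | A)%Z) by (apply Z.divide_trans with g; auto).
  apply Gauss with (a * b0)%Z.
  - destruct (Z.divide_trans _ _ _ He1 Hg1) as [k Hk].
    destruct (Z.divide_trans _ _ _ He2 Hh1) as [k' Hk'].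
    exists (k + k')%Z. lia.
  - apply rel_prime_div with (2 := HeA). apply rel_prime_mult; auto.
Qed.

(** The cross product of the [y]-vectors of [p] and of the reference [q] gives three minors, one for
    each coefficient. A class is a divisor of its [Ai], so counting classes means counting
    divisors. *)
Definition class1 (q p : param) : Z := Z.gcd (A1 p) (y2 p * y3 q - y3 p * y2 q).
Definition class2 (q p : param) : Z := Z.gcd (A2 p) (y3 p * y1 q - y1 p * y3 q).
Definition class3 (q p : param) : Z := Z.gcd (A3 p) (y1 p * y2 q - y2 p * y1 q).

Record same_coeffs (p q : param) : Prop := {
  same_s1 : s1 p = s1 q; same_s2 : s2 p = s2 q; same_s3 : s3 p = s3 q;
  same_A1 : A1 p = A1 q; same_A2 : A2 p = A2 q; same_A3 : A3 p = A3 q }.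

(** The determinant with rows [(y1, y2, y3)] of [p], [q], [r], expanded along the first column. *)
Definition det3 (p q r : param) : Z :=
  (y1 p * (y2 q * y3 r - y3 q * y2 r) + y1 q * (y2 r * y3 p - y3 r * y2 p)
   + y1 r * (y2 p * y3 q - y3 p * y2 q))%Z.

Lemma conic_mod (p : param) : on_conic p ->
  (A1 p | s2 p * A2 p * y2 p ^ 2 + s3 p * A3 p * y3 p ^ 2)%Z /\
  (A2 p | s3 p * A3 p * y3 p ^ 2 + s1 p * A1 p * y1 p ^ 2)%Z /\
  (A3 p | s1 p * A1 p * y1 p ^ 2 + s2 p * A2 p * y2 p ^ 2)%Z.
Proof.
  intros Hp. assert (E := conic_eq p Hp).
  split; [|split].
  - exists (- (s1 p * y1 p ^ 2))%Z. lia.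
  - exists (- (s2 p * y2 p ^ 2))%Z. lia.
  - exists (- (s3 p * y3 p ^ 2))%Z. lia.
Qed.

Lemma conic_coprime (p : param) : on_conic p ->
  (rel_prime (A1 p) (s2 p * A2 p) /\ rel_prime (A1 p) (y2 p) /\ rel_prime (A1 p) (y3 p)) /\
  (rel_prime (A2 p) (s3 p * A3 p) /\ rel_prime (A2 p) (y3 p) /\ rel_prime (A2 p) (y1 p)) /\
  (rel_prime (A3 p) (s1 p * A1 p) /\ rel_prime (A3 p) (y1 p) /\ rel_prime (A3 p) (y2 p)).
Proof.
  intros Hp. assert (C12 := coprime12 p Hp). assert (C13 := coprime13 p Hp).
  assert (C23 := coprime23 p Hp).
  assert (C21 := rel_prime_sym _ _ C12). assert (C31 := rel_prime_sym _ _ C13).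
  assert (C32 := rel_prime_sym _ _ C23).
  assert (DA : forall s A y, (A | s * A * y)%Z) by (intros s A y; exists (s * y)%Z; ring).
  assert (Dy : forall s A y, (y | s * A * y)%Z) by (intros s A y; exists (s * A)%Z; ring).
  assert (Ds : forall s A y, (s * A | s * A * y)%Z) by (intros s A y; exists y; ring).
  assert (K : forall s A y s' A' y', rel_prime (s * A * y) (s' * A' * y') ->
    rel_prime A (s' * A') /\ rel_prime A y').
  { intros s A y s' A' y' H. split; apply rel_prime_dvd with (1 := H); auto. }
  destruct (K _ _ _ _ _ _ C12), (K _ _ _ _ _ _ C13), (K _ _ _ _ _ _ C23),
    (K _ _ _ _ _ _ C21), (K _ _ _ _ _ _ C31), (K _ _ _ _ _ _ C32). auto 6.
Qed.

Lemma minor1_dvd q p r :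
  on_conic q -> on_conic p -> on_conic r -> same_coeffs p q -> same_coeffs r q ->
  class1 q p = class1 q r -> (A1 p | 2 * (y2 p * y3 r - y3 p * y2 r))%Z.
Proof.
  intros Hq Hp Hr [E1 E2 E3 F1 F2 F3] [E1' E2' E3' F1' F2' F3'] Hc.
  destruct (conic_mod p Hp) as (Mp & _), (conic_mod q Hq) as (Mq & _), (conic_mod r Hr) as (Mr & _).
  destruct (conic_coprime p Hp) as ((Cp & Cp' & Cp'') & _).
  destruct (conic_coprime q Hq) as ((Cq & Cq' & Cq'') & _).
  unfold class1 in Hc.
  rewrite <- F1, <- E2, <- F2, <- E3, <- F3 in Mq.
  rewrite F1', <- F1, E2', <- E2, F2', <- F2, E3', <- E3, F3', <- F3 in Mr.
  rewrite F1', <- F1 in Hc. rewrite <- F1 in Cq''.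
  apply minor_dvd with (1 := A1_neq0 p Hp) (2 := Mp) (3 := Mr) (4 := Mq); auto.
Qed.

Lemma minor2_dvd q p r :
  on_conic q -> on_conic p -> on_conic r -> same_coeffs p q -> same_coeffs r q ->
  class2 q p = class2 q r -> (A2 p | 2 * (y3 p * y1 r - y1 p * y3 r))%Z.
Proof.
  intros Hq Hp Hr [E1 E2 E3 F1 F2 F3] [E1' E2' E3' F1' F2' F3'] Hc.
  destruct (conic_mod p Hp) as (_ & Mp & _), (conic_mod q Hq) as (_ & Mq & _), (conic_mod r Hr) as (_ & Mr & _).
  destruct (conic_coprime p Hp) as (_ & (Cp & Cp' & Cp'') & _).
  destruct (conic_coprime q Hq) as (_ & (Cq & Cq' & Cq'') & _).
  unfold class2 in Hc.
  rewrite <- F1, <- E1, <- F2, <- E3, <- F3 in Mq.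
  rewrite F1', <- F1, E1', <- E1, F2', <- F2, E3', <- E3, F3', <- F3 in Mr.
  rewrite F2', <- F2 in Hc. rewrite <- F2 in Cq''.
  apply minor_dvd with (1 := A2_neq0 p Hp) (2 := Mp) (3 := Mr) (4 := Mq); auto.
Qed.

Lemma minor3_dvd q p r :
  on_conic q -> on_conic p -> on_conic r -> same_coeffs p q -> same_coeffs r q ->
  class3 q p = class3 q r -> (A3 p | 2 * (y1 p * y2 r - y2 p * y1 r))%Z.
Proof.
  intros Hq Hp Hr [E1 E2 E3 F1 F2 F3] [E1' E2' E3' F1' F2' F3'] Hc.
  destruct (conic_mod p Hp) as (_ & _ & Mp), (conic_mod q Hq) as (_ & _ & Mq), (conic_mod r Hr) as (_ & _ & Mr).
  destruct (conic_coprime p Hp) as (_ & _ & (Cp & Cp' & Cp'')).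
  destruct (conic_coprime q Hq) as (_ & _ & (Cq & Cq' & Cq'')).
  unfold class3 in Hc.
  rewrite <- F1, <- E1, <- F2, <- E2, <- F3 in Mq.
  rewrite F1', <- F1, E1', <- E1, F2', <- F2, E2', <- E2, F3', <- F3 in Mr.
  rewrite F3', <- F3 in Hc. rewrite <- F3 in Cq''.
  apply minor_dvd with (1 := A3_neq0 p Hp) (2 := Mp) (3 := Mr) (4 := Mq); auto.
Qed.

Lemma rel_prime_mul_dvd a b m : rel_prime a b -> (a | m)%Z -> (b | m)%Z -> (a * b | m)%Z.
Proof.
  intros Hab [k ->] Hb. rewrite Z.mul_comm. apply Z.mul_divide_mono_r.
  apply Gauss with a; [rewrite Z.mul_comm; auto|apply rel_prime_sym; auto].
Qed.

(** Expanding along column [i] exhibits minors which, when doubled, are divisible by [Ai], because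
    the three points share their class. The [Ai] are pairwise coprime, so their product divides
    twice the determinant. *)
Lemma det3_dvd q x y z :
  on_conic q -> on_conic x -> on_conic y -> on_conic z ->
  same_coeffs x q -> same_coeffs y q -> same_coeffs z q ->
  class1 q x = class1 q y -> class1 q x = class1 q z ->
  class2 q x = class2 q y -> class2 q x = class2 q z ->
  class3 q x = class3 q y -> class3 q x = class3 q z ->
  (A1 q * A2 q * A3 q | 2 * det3 x y z)%Z.
Proof.
  intros Hq Hx Hy Hz Sx Sy Sz K1 K1' K2 K2' K3 K3'.
  assert (T : forall A a b c u v w, (A | 2 * u)%Z -> (A | 2 * v)%Z -> (A | 2 * w)%Z ->
    (A | 2 * (a * u + b * v + c * w))%Z).
  { intros A a b c u v w [k Hk] [l Hl] [m Hm]. exists (a * k + b * l + c * m)%Z.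
    transitivity (a * (2 * u) + b * (2 * v) + c * (2 * w))%Z; [ring|].
    rewrite Hk, Hl, Hm. ring. }
  destruct (conic_coprime q Hq) as ((C12 & _ & _) & (C23 & _ & _) & (C31 & _ & _)).
  apply rel_prime_mul_dvd; [|apply rel_prime_mul_dvd|].
  - apply rel_prime_sym. apply rel_prime_mult.
    + apply rel_prime_dvd with (1 := C31); [exists 1%Z; ring|exists (s1 q); ring].
    + apply rel_prime_sym.
      apply rel_prime_dvd with (1 := C23); [exists 1%Z; ring|exists (s3 q); ring].
  - apply rel_prime_dvd with (1 := C12); [exists 1%Z; ring|exists (s2 q); ring].
  - unfold det3. apply T.
    + rewrite <- (same_A1 _ _ Sy). apply minor1_dvd with q; auto. congruence.
    + rewrite <- (same_A1 _ _ Sz). apply minor1_dvd with q; auto.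
    + rewrite <- (same_A1 _ _ Sx). apply minor1_dvd with q; auto.
  - replace (det3 x y z) with (y2 x * (y3 y * y1 z - y1 y * y3 z) + y2 y * (y3 z * y1 x - y1 z * y3 x)
      + y2 z * (y3 x * y1 y - y1 x * y3 y))%Z by (unfold det3; ring).
    apply T.
    + rewrite <- (same_A2 _ _ Sy). apply minor2_dvd with q; auto. congruence.
    + rewrite <- (same_A2 _ _ Sz). apply minor2_dvd with q; auto.
    + rewrite <- (same_A2 _ _ Sx). apply minor2_dvd with q; auto.
  - replace (det3 x y z) with (y3 x * (y1 y * y2 z - y2 y * y1 z) + y3 y * (y1 z * y2 x - y2 z * y1 x)
      + y3 z * (y1 x * y2 y - y2 x * y1 y))%Z by (unfold det3; ring).
    apply T.
    + rewrite <- (same_A3 _ _ Sy). apply minor3_dvd with q; auto. congruence.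
    + rewrite <- (same_A3 _ _ Sz). apply minor3_dvd with q; auto.
    + rewrite <- (same_A3 _ _ Sx). apply minor3_dvd with q; auto.
Qed.

(** * Geometry of a real conic in the positive quadrant *)

Lemma Rmult_eq_cancel k x y : k <> 0 -> k * x = k * y -> x = y.
Proof. intros. apply Rmult_eq_reg_l with k; auto. Qed.

Lemma conic_chord a b c u w u' w' :
  a * u ^ 2 + b * w ^ 2 = c -> a * u' ^ 2 + b * w' ^ 2 = c ->
  a * ((u - u') * (u + u')) = - b * ((w - w') * (w + w')).
Proof. intros. nra. Qed.

Lemma conic_abscissa_inj a b c u w u' w' :
  b <> 0 -> 0 < w -> 0 < w' ->
  a * u ^ 2 + b * w ^ 2 = c -> a * u' ^ 2 + b * w' ^ 2 = c -> u = u' -> w = w'.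
Proof.
  intros Hb Hw Hw' E E' ->.
  assert (b * (w * w) = b * (w' * w')) by nra.
  apply Rmult_eq_cancel in H; auto. nra.
Qed.

(** Multiplying the chord relations crosswise and cancelling with the collinearity relation gives
    the same relation for sums of coordinates in place of differences. Subtracting the two shows
    that the first point has equal cross products with the other two. *)
Lemma collinear_on_conic_step a b c u1 w1 u2 w2 u3 w3 :
  a <> 0 -> b <> 0 ->
  a * u1 ^ 2 + b * w1 ^ 2 = c -> a * u2 ^ 2 + b * w2 ^ 2 = c -> a * u3 ^ 2 + b * w3 ^ 2 = c ->
  (u2 - u1) * (w3 - w1) = (u3 - u1) * (w2 - w1) -> u2 <> u1 -> w3 <> w1 ->
  u1 * w3 - u3 * w1 = u1 * w2 - u2 * w1.
Proof.
  intros Ha Hb E1 E2 E3 L Hu Hw.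
  assert (C2 := conic_chord _ _ _ _ _ _ _ E2 E1). assert (C3 := conic_chord _ _ _ _ _ _ _ E3 E1).
  assert (K : (u2 + u1) * (w3 + w1) = (u3 + u1) * (w2 + w1)).
  { apply Rmult_eq_cancel with ((- b * a) * ((u2 - u1) * (w3 - w1))).
    { repeat apply Rmult_integral_contrapositive_currified; auto; lra. }
    transitivity ((a * ((u2 - u1) * (u2 + u1))) * (- b * ((w3 - w1) * (w3 + w1)))); [ring|].
    rewrite C2, <- C3. rewrite L. ring. }
  lra.
Qed.

(** The step, applied at each of the three points, forces [u1 w2 - u2 w1] to equal its own negative.
    So the first two points are proportional, and [c <> 0] with positivity makes them equal. *)
Lemma collinear_on_conic a b c u1 w1 u2 w2 u3 w3 :
  a <> 0 -> b <> 0 -> c <> 0 ->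
  0 < u1 -> 0 < u2 -> 0 < u3 -> 0 < w1 -> 0 < w2 -> 0 < w3 ->
  a * u1 ^ 2 + b * w1 ^ 2 = c -> a * u2 ^ 2 + b * w2 ^ 2 = c -> a * u3 ^ 2 + b * w3 ^ 2 = c ->
  (u2 - u1) * (w3 - w1) = (u3 - u1) * (w2 - w1) ->
  u1 = u2 \/ u2 = u3 \/ u1 = u3.
Proof.
  intros Ha Hb Hc U1 U2 U3 W1 W2 W3 E1 E2 E3 L.
  destruct (Req_dec u1 u2) as [|N12]; auto.
  destruct (Req_dec u2 u3) as [|N23]; auto.
  destruct (Req_dec u1 u3) as [|N13]; auto.
  exfalso.
  assert (E1' : b * w1 ^ 2 + a * u1 ^ 2 = c) by lra.
  assert (E2' : b * w2 ^ 2 + a * u2 ^ 2 = c) by lra.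
  assert (E3' : b * w3 ^ 2 + a * u3 ^ 2 = c) by lra.
  assert (M12 : w1 <> w2) by (intros F; apply N12; apply (conic_abscissa_inj b a c w1 u1 w2 u2); auto).
  assert (M23 : w2 <> w3) by (intros F; apply N23; apply (conic_abscissa_inj b a c w2 u2 w3 u3); auto).
  assert (M13 : w1 <> w3) by (intros F; apply N13; apply (conic_abscissa_inj b a c w1 u1 w3 u3); auto).
  assert (S1 := collinear_on_conic_step a b c u1 w1 u2 w2 u3 w3 Ha Hb E1 E2 E3 L ltac:(auto) ltac:(auto)).
  assert (S2 := collinear_on_conic_step a b c u2 w2 u3 w3 u1 w1 Ha Hb E2 E3 E1 ltac:(lra) ltac:(auto) ltac:(auto)).
  assert (S3 := collinear_on_conic_step a b c u3 w3 u1 w1 u2 w2 Ha Hb E3 E1 E2 ltac:(lra) ltac:(auto) ltac:(auto)).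
  assert (Z12 : u1 * w2 = u2 * w1) by lra.
  assert (Hsq : c * u2 ^ 2 = c * u1 ^ 2).
  { rewrite <- E1 at 1. rewrite <- E2.
    transitivity (a * (u1 ^ 2 * u2 ^ 2) + b * (u2 * w1) ^ 2); [ring|]. rewrite <- Z12. ring. }
  apply Rmult_eq_cancel in Hsq; auto. apply N12. apply Rsqr_inj; unfold Rsqr; lra.
Qed.

(* On each branch of the conic [w] is a monotone function of [u], so [u + sg w] controls both. *)
Lemma conic_monotone a b c u w u' w' sg :
  a <> 0 -> b <> 0 -> 0 < u -> 0 < w -> 0 < u' -> 0 < w' ->
  a * u ^ 2 + b * w ^ 2 = c -> a * u' ^ 2 + b * w' ^ 2 = c ->
  (sg = 1 /\ a * b < 0 \/ sg = -1 /\ 0 < a * b) ->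
  Rabs (u - u') <= Rabs (u + sg * w - (u' + sg * w')) /\
  Rabs (w - w') <= Rabs (u + sg * w - (u' + sg * w')).
Proof.
  intros Ha Hb U W U' W' E E' Hs.
  assert (C := conic_chord _ _ _ _ _ _ _ E E').
  set (D := u - u') in *. set (F := w - w') in *.
  assert (K : b ^ 2 * (w + w') * (D * F) = - (a * b) * (D ^ 2 * (u + u'))).
  { transitivity (- b * D * (- b * (F * (w + w')))); [ring|]. rewrite <- C. ring. }
  assert (Hb2 : 0 < b ^ 2 * (w + w')).
  { apply Rmult_lt_0_compat; [|lra]. rewrite <- Rsqr_pow2. apply Rsqr_pos_lt; auto. }
  assert (HD : 0 <= D ^ 2 * (u + u')).
  { apply Rmult_le_pos; [|lra]. apply pow2_ge_0. }
  assert (Hpos : 0 <= sg * (D * F)).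
  { apply Rmult_le_reg_l with (1 := Hb2). rewrite Rmult_0_r.
    replace (b ^ 2 * (w + w') * (sg * (D * F))) with (sg * (b ^ 2 * (w + w') * (D * F))) by ring.
    rewrite K. destruct Hs as [[-> Hs]|[-> Hs]]; nra. }
  replace (u + sg * w - (u' + sg * w')) with (D + sg * F) by (unfold D, F; ring).
  assert (Hs2 : sg ^ 2 = 1) by (destruct Hs as [[-> _]|[-> _]]; ring).
  split; apply Rsqr_le_abs_0; unfold Rsqr; nra.
Qed.

(** Dividing by the dyadic sizes makes the affine coordinates of the point bounded: they lie in
    [(0, 8]] whatever the box. *)
Definition slope1 (b1 b3 : nat) (p : param) : R :=
  (IZR (y1 p) / 8 ^ b1) / (IZR (y3 p) / 8 ^ b3).
Definition slope2 (b2 b3 : nat) (p : param) : R :=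
  (IZR (y2 p) / 8 ^ b2) / (IZR (y3 p) / 8 ^ b3).
(** In the positive quadrant the conic of slopes rises if [A1 A2 < 0] and falls if [A1 A2 > 0]; with
    this sign the increments of the two slopes add up in [conic_coord] and never cancel. *)
Definition branch_sign (p : param) : R := IZR (- Z.sgn (A1 p * A2 p)).
Definition conic_coord (b1 b2 b3 : nat) (p : param) : R :=
  slope1 b1 b3 p + branch_sign p * slope2 b2 b3 p.

Lemma pow_pos_nat b n : 0 < b -> 0 < b ^ n.
Proof. intros. apply pow_lt; auto. Qed.

Lemma scaled_range y b : (0 < y)%Z -> log8 y = b -> 1 <= IZR y / 8 ^ b < 8.
Proof.
  intros H <-. destruct (log8_spec y H) as [L U].
  assert (0 < 8 ^ log8 y) by (apply pow_lt; lra).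
  split.
  - apply Rmult_le_reg_r with (8 ^ log8 y); auto. unfold Rdiv.
    rewrite Rmult_assoc, Rinv_l by lra. lra.
  - apply Rmult_lt_reg_r with (8 ^ log8 y); auto. unfold Rdiv.
    rewrite Rmult_assoc, Rinv_l by lra. lra.
Qed.

Lemma ratio_range x y : 1 <= x < 8 -> 1 <= y < 8 -> 0 < x / y <= 8.
Proof.
  intros Hx Hy. split; [apply Rdiv_lt_0_compat; lra|].
  apply Rmult_le_reg_r with y; [lra|]. unfold Rdiv. rewrite Rmult_assoc, Rinv_l by lra. lra.
Qed.

Record in_dyadic (b1 b2 b3 : nat) (p : param) : Prop := {
  dyadic1 : log8 (y1 p) = b1; dyadic2 : log8 (y2 p) = b2; dyadic3 : log8 (y3 p) = b3 }.

Lemma slopes_on_conic b1 b2 b3 p :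
  on_conic p -> in_dyadic b1 b2 b3 p ->
  0 < slope1 b1 b3 p <= 8 /\ 0 < slope2 b2 b3 p <= 8 /\
  IZR (s1 p * A1 p) * (8 ^ b1) ^ 2 * slope1 b1 b3 p ^ 2 +
  IZR (s2 p * A2 p) * (8 ^ b2) ^ 2 * slope2 b2 b3 p ^ 2 = - IZR (s3 p * A3 p) * (8 ^ b3) ^ 2.
Proof.
  intros Hp [D1 D2 D3].
  assert (R1 := scaled_range _ _ (y1_pos p Hp) D1).
  assert (R2 := scaled_range _ _ (y2_pos p Hp) D2).
  assert (R3 := scaled_range _ _ (y3_pos p Hp) D3).
  split; [apply ratio_range; auto|]. split; [apply ratio_range; auto|].
  unfold slope1, slope2.
  assert (B1 := pow_pos_nat 8 b1 ltac:(lra)). assert (B2 := pow_pos_nat 8 b2 ltac:(lra)).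
  assert (B3 := pow_pos_nat 8 b3 ltac:(lra)).
  assert (Y3 : 0 < IZR (y3 p)) by (apply IZR_lt, Hp).
  assert (E := f_equal IZR (conic_eq p Hp)).
  rewrite !plus_IZR, !mult_IZR, !Z.pow_2_r, !mult_IZR in E.
  rewrite !mult_IZR.
  apply Rmult_eq_cancel with (IZR (y3 p) ^ 2 / (8 ^ b3) ^ 2).
  { apply Rgt_not_eq, Rdiv_lt_0_compat; apply pow_lt; auto. }
  transitivity (IZR (s1 p) * IZR (A1 p) * IZR (y1 p) ^ 2 + IZR (s2 p) * IZR (A2 p) * IZR (y2 p) ^ 2).
  { field. repeat split; lra. }
  transitivity (- (IZR (s3 p) * IZR (A3 p) * IZR (y3 p) ^ 2)).
  { clear - E. lra. }
  field. lra.
Qed.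

(** Dividing each row by its [y3] turns the determinant into that of the affine points [(u, w, 1)],
    which is twice the signed area of their triangle. *)
Lemma det3_slopes b1 b2 b3 x y z :
  on_conic x -> on_conic y -> on_conic z ->
  IZR (det3 x y z) = 8 ^ b1 * 8 ^ b2 * 8 ^ b3 *
    ((IZR (y3 x) / 8 ^ b3) * (IZR (y3 y) / 8 ^ b3) * (IZR (y3 z) / 8 ^ b3)) *
    ((slope1 b1 b3 y - slope1 b1 b3 x) * (slope2 b2 b3 z - slope2 b2 b3 x)
     - (slope1 b1 b3 z - slope1 b1 b3 x) * (slope2 b2 b3 y - slope2 b2 b3 x)).
Proof.
  intros Hx Hy Hz. unfold det3, slope1, slope2.
  assert (B1 := pow_pos_nat 8 b1 ltac:(lra)). assert (B2 := pow_pos_nat 8 b2 ltac:(lra)).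
  assert (B3 := pow_pos_nat 8 b3 ltac:(lra)).
  assert (X3 : 0 < IZR (y3 x)) by (apply IZR_lt, Hx).
  assert (Y3 : 0 < IZR (y3 y)) by (apply IZR_lt, Hy).
  assert (Z3 : 0 < IZR (y3 z)) by (apply IZR_lt, Hz).
  rewrite !plus_IZR, !mult_IZR, !minus_IZR, !mult_IZR. field. repeat split; lra.
Qed.

Lemma same_slopes_eq b1 b2 b3 x y :
  on_conic x -> on_conic y -> same_coeffs x y -> pd x = pd y -> pt x = pt y ->
  slope1 b1 b3 x = slope1 b1 b3 y -> slope2 b2 b3 x = slope2 b2 b3 y -> x = y.
Proof.
  intros Hx Hy [E1 E2 E3 F1 F2 F3] Ed Et G1 G2. unfold slope1, slope2 in *.
  assert (B1 := pow_pos_nat 8 b1 ltac:(lra)). assert (B2 := pow_pos_nat 8 b2 ltac:(lra)).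
  assert (B3 := pow_pos_nat 8 b3 ltac:(lra)).
  assert (X3 : 0 < IZR (y3 x)) by (apply IZR_lt, Hx).
  assert (Y3 : 0 < IZR (y3 y)) by (apply IZR_lt, Hy).
  assert (K1 : (y1 x * y3 y = y3 x * y1 y)%Z).
  { apply eq_IZR. rewrite !mult_IZR.
    apply (f_equal (fun r => r * (8 ^ b1 / 8 ^ b3) * IZR (y3 x) * IZR (y3 y))) in G1.
    field_simplify in G1; lra. }
  assert (K2 : (y2 x * y3 y = y3 x * y2 y)%Z).
  { apply eq_IZR. rewrite !mult_IZR.
    apply (f_equal (fun r => r * (8 ^ b2 / 8 ^ b3) * IZR (y3 x) * IZR (y3 y))) in G2.
    field_simplify in G2; lra. }
  assert (J : forall u v, on_conic v -> u = v -> rel_prime (y1 v) (y3 v)).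
  { intros u v Hv _. apply rel_prime_dvd with (1 := coprime13 v Hv);
      [exists (s1 v * A1 v)%Z|exists (s3 v * A3 v)%Z]; ring. }
  assert (P3x := y3_pos x Hx). assert (P3y := y3_pos y Hy).
  destruct (proportional_coprime_eq (y1 x) (y3 x) (y1 y) (y3 y)) as [L1 L3]; eauto; try lia.
  assert (L2 : y2 x = y2 y).
  { rewrite <- L3 in K2. apply Z.mul_reg_r with (y3 x); lia. }
  clear - E1 E2 E3 F1 F2 F3 Ed Et L1 L2 L3.
  destruct x, y; simpl in *; subst; reflexivity.
Qed.

(* If the three points were distinct, their determinant would be a nonzero multiple of
   [A1 A2 A3 / 2] (a conic contains no three collinear points), too large for such close points. *)
Lemma close_conic_points q x y z b1 b2 b3 e :
  on_conic q -> on_conic x -> on_conic y -> on_conic z ->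
  same_coeffs x q -> same_coeffs y q -> same_coeffs z q ->
  pd x = pd y -> pd y = pd z -> pt x = pt y -> pt y = pt z ->
  in_dyadic b1 b2 b3 x -> in_dyadic b1 b2 b3 y -> in_dyadic b1 b2 b3 z ->
  class1 q x = class1 q y -> class1 q x = class1 q z ->
  class2 q x = class2 q y -> class2 q x = class2 q z ->
  class3 q x = class3 q y -> class3 q x = class3 q z ->
  Rabs (conic_coord b1 b2 b3 y - conic_coord b1 b2 b3 x) < e ->
  Rabs (conic_coord b1 b2 b3 z - conic_coord b1 b2 b3 x) < e ->
  2048 * (8 ^ b1 * 8 ^ b2 * 8 ^ b3) * (e * e) <= Rabs (IZR (A1 q * A2 q * A3 q)) ->
  x = y \/ y = z \/ x = z.
Proof.
  intros Hq Hx Hy Hz Sx Sy Sz D1 D2 T1 T2 Ix Iy Iz K1 K1' K2 K2' K3 K3' Ey Ez He.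
  destruct (slopes_on_conic _ _ _ _ Hx Ix) as (Ux & Wx & Cx).
  destruct (slopes_on_conic _ _ _ _ Hy Iy) as (Uy & Wy & Cy).
  destruct (slopes_on_conic _ _ _ _ Hz Iz) as (Uz & Wz & Cz).
  assert (Sxy : same_coeffs x y) by (destruct Sx, Sy; split; congruence).
  assert (Syz : same_coeffs y z) by (destruct Sy, Sz; split; congruence).
  assert (Sxz : same_coeffs x z) by (destruct Sx, Sz; split; congruence).
  rewrite <- (same_s1 _ _ Sxy), <- (same_s2 _ _ Sxy), <- (same_s3 _ _ Sxy),
    <- (same_A1 _ _ Sxy), <- (same_A2 _ _ Sxy), <- (same_A3 _ _ Sxy) in Cy.
  rewrite <- (same_s1 _ _ Sxz), <- (same_s2 _ _ Sxz), <- (same_s3 _ _ Sxz),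
    <- (same_A1 _ _ Sxz), <- (same_A2 _ _ Sxz), <- (same_A3 _ _ Sxz) in Cz.
  assert (By : branch_sign y = branch_sign x).
  { unfold branch_sign. rewrite (same_A1 _ _ Sxy), (same_A2 _ _ Sxy). reflexivity. }
  assert (Bz : branch_sign z = branch_sign x).
  { unfold branch_sign. rewrite (same_A1 _ _ Sxz), (same_A2 _ _ Sxz). reflexivity. }
  unfold conic_coord in Ey, Ez. rewrite By in Ey. rewrite Bz in Ez.
  assert (B1 := pow_pos_nat 8 b1 ltac:(lra)). assert (B2 := pow_pos_nat 8 b2 ltac:(lra)).
  assert (B3 := pow_pos_nat 8 b3 ltac:(lra)).
  assert (P1 := s1_pos x Hx). assert (P2 := s2_pos x Hx). assert (P3 := s3_pos x Hx).
  assert (N1 := A1_neq0 x Hx). assert (N2 := A2_neq0 x Hx). assert (N3 := A3_neq0 x Hx).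
  set (a := IZR (s1 x * A1 x) * (8 ^ b1) ^ 2) in *.
  set (b := IZR (s2 x * A2 x) * (8 ^ b2) ^ 2) in *.
  set (c := - IZR (s3 x * A3 x) * (8 ^ b3) ^ 2) in *.
  assert (Nz : forall s A B, (0 < s)%Z -> A <> 0%Z -> 0 < B -> IZR (s * A) * B ^ 2 <> 0).
  { intros s A B Hs HA HB. apply Rmult_integral_contrapositive_currified.
    - apply not_0_IZR. intros F. apply Z.mul_eq_0 in F. lia.
    - apply pow_nonzero; lra. }
  assert (Ha : a <> 0) by (apply Nz; auto). assert (Hb : b <> 0) by (apply Nz; auto).
  assert (Hc : c <> 0).
  { unfold c. rewrite Ropp_mult_distr_l_reverse. apply Ropp_neq_0_compat. apply Nz; auto. }
  assert (Hsg : branch_sign x = 1 /\ a * b < 0 \/ branch_sign x = -1 /\ 0 < a * b).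
  { assert (E : a * b = IZR (A1 x * A2 x) * (IZR (s1 x) * IZR (s2 x) * (8 ^ b1 * 8 ^ b2) ^ 2)).
    { unfold a, b. rewrite !mult_IZR. ring. }
    assert (Pos : 0 < IZR (s1 x) * IZR (s2 x) * (8 ^ b1 * 8 ^ b2) ^ 2).
    { apply Rmult_lt_0_compat; [apply Rmult_lt_0_compat; apply IZR_lt; auto|].
      apply pow_lt, Rmult_lt_0_compat; auto. }
    unfold branch_sign. rewrite E.
    assert (A1 x * A2 x <> 0)%Z by (intros F; apply Z.mul_eq_0 in F; tauto).
    destruct (Z.lt_trichotomy (A1 x * A2 x) 0) as [L|[L|L]]; [|contradiction|].
    - left. rewrite Z.sgn_neg by auto. split; [reflexivity|].
      apply IZR_lt in L. apply Ropp_lt_cancel. rewrite Ropp_0, <- Ropp_mult_distr_l_reverse.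
      apply Rmult_lt_0_compat; lra.
    - right. rewrite Z.sgn_pos by auto. split; [reflexivity|].
      apply IZR_lt in L. apply Rmult_lt_0_compat; auto. }
  destruct (conic_monotone a b c _ _ _ _ (branch_sign x) Ha Hb (proj1 Uy) (proj1 Wy) (proj1 Ux) (proj1 Wx) Cy Cx Hsg) as [My My'].
  destruct (conic_monotone a b c _ _ _ _ (branch_sign x) Ha Hb (proj1 Uz) (proj1 Wz) (proj1 Ux) (proj1 Wx) Cz Cx Hsg) as [Mz Mz'].
  assert (Hdet := det3_slopes b1 b2 b3 x y z Hx Hy Hz).
  assert (Hdvd := det3_dvd q x y z Hq Hx Hy Hz Sx Sy Sz K1 K1' K2 K2' K3 K3').
  assert (V3x := scaled_range _ _ (y3_pos x Hx) (dyadic3 _ _ _ _ Ix)).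
  assert (V3y := scaled_range _ _ (y3_pos y Hy) (dyadic3 _ _ _ _ Iy)).
  assert (V3z := scaled_range _ _ (y3_pos z Hz) (dyadic3 _ _ _ _ Iz)).
  set (V := IZR (y3 x) / 8 ^ b3 * (IZR (y3 y) / 8 ^ b3) * (IZR (y3 z) / 8 ^ b3)) in *.
  set (Y := 8 ^ b1 * 8 ^ b2 * 8 ^ b3) in *.
  assert (HY : 0 < Y) by (repeat apply Rmult_lt_0_compat; auto).
  assert (HV : 0 < V <= 512).
  { unfold V. clear - V3x V3y V3z.
    set (vx := IZR (y3 x) / 8 ^ b3) in *. set (vy := IZR (y3 y) / 8 ^ b3) in *.
    set (vz := IZR (y3 z) / 8 ^ b3) in *. clearbody vx vy vz.
    split; [repeat apply Rmult_lt_0_compat; lra|].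
    replace 512 with (8 * 8 * 8) by ring.
    repeat apply Rmult_le_compat; try lra. apply Rmult_le_pos; lra. }
  set (uy := slope1 b1 b3 y - slope1 b1 b3 x) in *. set (uz := slope1 b1 b3 z - slope1 b1 b3 x) in *.
  set (wy := slope2 b2 b3 y - slope2 b2 b3 x) in *. set (wz := slope2 b2 b3 z - slope2 b2 b3 x) in *.
  destruct (Z.eq_dec (det3 x y z) 0) as [Z0|Z0].
  - rewrite Z0 in Hdet. symmetry in Hdet. apply Rmult_integral in Hdet.
    destruct Hdet as [F|L].
    { exfalso. apply Rmult_integral in F. lra. }
    assert (L' : uy * wz = uz * wy) by lra.
    destruct (collinear_on_conic a b c _ _ _ _ _ _ Ha Hb Hc (proj1 Ux) (proj1 Uy) (proj1 Uz)
      (proj1 Wx) (proj1 Wy) (proj1 Wz) Cx Cy Cz L') as [F|[F|F]].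
    + left. apply same_slopes_eq with (b1 := b1) (b2 := b2) (b3 := b3); auto.
      apply (conic_abscissa_inj a b c (slope1 b1 b3 x) _ (slope1 b1 b3 y)); tauto.
    + right; left. apply same_slopes_eq with (b1 := b1) (b2 := b2) (b3 := b3); auto.
      apply (conic_abscissa_inj a b c (slope1 b1 b3 y) _ (slope1 b1 b3 z)); tauto.
    + right; right. apply same_slopes_eq with (b1 := b1) (b2 := b2) (b3 := b3); auto; try congruence.
      apply (conic_abscissa_inj a b c (slope1 b1 b3 x) _ (slope1 b1 b3 z)); tauto.
  - exfalso.
    (* The constant 2048 is [2 * 512 * 2]: the factor 2 of the divisibility, the bound [8^3] for
       [V], and the two products of increments, each below [e^2]. *)
    assert (Hle := dvd_abs_le _ _ Hdvd ltac:(lia)).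
    rewrite (mult_IZR 2), (Rabs_mult 2), (Rabs_pos_eq 2) in Hle by lra.
    assert (He0 : 0 < e) by (generalize (Rabs_pos uy); lra).
    assert (Hd : Rabs (uy * wz - uz * wy) < 2 * (e * e)).
    { apply Rle_lt_trans with (Rabs (uy * wz) + Rabs (uz * wy)).
      - unfold Rminus. rewrite <- (Rabs_Ropp (uz * wy)). apply Rabs_triang.
      - rewrite !Rabs_mult.
        assert (Rabs uy * Rabs wz < e * e) by (apply Rmult_le_0_lt_compat; try apply Rabs_pos; lra).
        assert (Rabs uz * Rabs wy < e * e) by (apply Rmult_le_0_lt_compat; try apply Rabs_pos; lra).
        lra. }
    rewrite Hdet, Rabs_mult, (Rabs_pos_eq (Y * V)) in Hle by (apply Rmult_le_pos; lra).
    assert (Y * V * Rabs (uy * wz - uz * wy) < Y * 512 * (2 * (e * e))).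
    { apply Rle_lt_trans with (Y * 512 * Rabs (uy * wz - uz * wy)).
      - apply Rmult_le_compat_r; [apply Rabs_pos|]. apply Rmult_le_compat_l; lra.
      - apply Rmult_lt_compat_l; lra. }
    lra.
Qed.

(** Each [Ai] is counted together with its class, at cost [3 * (4 * 4^ai) * L]. Once all three are
    fixed, every cell of [conic_coord] holds at most two points, and there are [O(sqrt(Y/X))] cells.
    The constant is [12^3 * 4100]; the hypothesis [X <= Y] makes the number of cells absorb the
    additive constants. *)
Lemma at_most_conic_box d t c1 c2 c3 a1 a2 a3 b1 b2 b3 N :
  4 * 4 ^ a1 <= N -> 4 * 4 ^ a2 <= N -> 4 * 4 ^ a3 <= N ->
  4 ^ a1 * 4 ^ a2 * 4 ^ a3 <= 8 ^ b1 * 8 ^ b2 * 8 ^ b3 ->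
  at_most (fun p => on_conic p /\ in_box d t c1 c2 c3 a1 a2 a3 b1 b2 b3 p)
    (7084800 * (1 + ln N) ^ 3 * (4 ^ a1 * 4 ^ a2 * 4 ^ a3 *
       sqrt (8 ^ b1 * 8 ^ b2 * 8 ^ b3 / (4 ^ a1 * 4 ^ a2 * 4 ^ a3)))).
Proof.
  intros N1 N2 N3 HXY.
  set (P := fun p => on_conic p /\ in_box d t c1 c2 c3 a1 a2 a3 b1 b2 b3 p).
  assert (P4 : forall n, 1 <= 4 ^ n) by (intros; apply pow_R1_Rle; lra).
  set (X := 4 ^ a1 * 4 ^ a2 * 4 ^ a3) in *. set (Y := 8 ^ b1 * 8 ^ b2 * 8 ^ b3) in *.
  assert (HX : 0 < X) by (repeat apply Rmult_lt_0_compat; apply pow_lt; lra).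
  set (rho := sqrt (Y / X)).
  assert (Hrho2 : rho * rho = Y / X).
  { apply sqrt_sqrt. apply Rlt_le, Rdiv_lt_0_compat; lra. }
  assert (Hrho : 1 <= rho).
  { rewrite <- sqrt_1. apply sqrt_le_1_alt. apply Rmult_le_reg_r with X; auto.
    unfold Rdiv. rewrite Rmult_assoc, Rinv_l by lra. lra. }
  assert (HL : 0 <= ln N) by (apply ln_nonneg; generalize (P4 a1); lra).
  set (L := 1 + ln N) in *.
  assert (HC : 0 <= 4100 * rho) by lra.
  assert (HC3 : 0 <= 3 * (4 * 4 ^ a3) * L * (4100 * rho)).
  { generalize (P4 a3). intros. unfold L. repeat apply Rmult_le_pos; lra. }
  assert (HC2 : 0 <= 3 * (4 * 4 ^ a2) * L * (3 * (4 * 4 ^ a3) * L * (4100 * rho))).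
  { generalize (P4 a2). intros. apply Rmult_le_pos; auto. unfold L. repeat apply Rmult_le_pos; lra. }
  replace (7084800 * L ^ 3 * (X * rho)) with
    (3 * (4 * 4 ^ a1) * L * (3 * (4 * 4 ^ a2) * L * (3 * (4 * 4 ^ a3) * L * (4100 * rho))))
    by (unfold X; ring).
  apply at_most_inhabited.
  { generalize (P4 a1). intros. apply Rmult_le_pos; auto. unfold L. repeat apply Rmult_le_pos; lra. }
  intros p0 _.
  (* One reference solution is chosen for each triple of coefficients. By [Hext] it depends on the
     triple only, so solutions with equal coefficients have comparable classes. *)
  set (rep := fun p => epsilon (inhabits p0)
    (fun q => P q /\ A1 q = A1 p /\ A2 q = A2 p /\ A3 q = A3 p)).
  assert (Hrep : forall p, P p -> P (rep p) /\ A1 (rep p) = A1 p /\ A2 (rep p) = A2 p /\ A3 (rep p) = A3 p).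
  { intros p Hp. apply epsilon_spec. exists p. auto. }
  assert (Hext : forall p p', A1 p = A1 p' -> A2 p = A2 p' -> A3 p = A3 p' -> rep p = rep p').
  { intros p p' E1 E2 E3. unfold rep. rewrite E1, E2, E3. reflexivity. }
  assert (Hdiv : forall A a u, A <> 0%Z -> log4 A = a ->
    (0 < Z.gcd A u)%Z /\ (Z.gcd A u | A)%Z /\ A <> 0%Z /\ Rabs (IZR A) <= 4 * 4 ^ a).
  { intros A a u HA <-. split; [|split; [apply Z.gcd_divide_l|split; auto]].
    - assert (Z.gcd A u <> 0)%Z by (intros E; apply Z.gcd_eq_0_l in E; auto).
      generalize (Z.gcd_nonneg A u). lia.
    - left. apply log4_spec; auto. }
  unfold L in *.
  apply at_most_fiber_divisor with (f := A1) (g := fun p => class1 (rep p) p); auto.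
  { generalize (P4 a1). lra. }
  { intros p [Hp Hb]. apply Hdiv; [apply Hp|apply Hb]. }
  intros m1 g1.
  apply at_most_fiber_divisor with (f := A2) (g := fun p => class2 (rep p) p); auto.
  { generalize (P4 a2). lra. }
  { intros p [[Hp Hb] _]. apply Hdiv; [apply Hp|apply Hb]. }
  intros m2 g2.
  apply at_most_fiber_divisor with (f := A3) (g := fun p => class3 (rep p) p); auto.
  { generalize (P4 a3). lra. }
  { intros p [[[Hp Hb] _] _]. apply Hdiv; [apply Hp|apply Hb]. }
  intros m3 g3.
  (* With [e = 1 / k] the closeness condition reads [2048 Y e^2 = X / 2], below [|A1 A2 A3|]. Two
     points in each of at most [2048 rho + 2] cells give [4100 rho], as [rho >= 1]. *)
  set (k := 64 * rho).
  apply at_most_le with ((16 * k + 1 - - (16 * k) + 1) * 2); [unfold k; lra|].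
  apply at_most_fiber_Z with (f := fun p => up (k * conic_coord b1 b2 b3 p)); try (unfold k; lra).
  - intros p [[[[Hp Hb] _] _] _]. apply up_range.
    destruct (slopes_on_conic b1 b2 b3 p Hp) as (U & W & _); [split; apply Hb|].
    rewrite Rabs_mult, (Rabs_pos_eq k) by (unfold k; lra). rewrite (Rmult_comm 16).
    apply Rmult_le_compat_l; [unfold k; lra|]. unfold conic_coord.
    assert (S : -1 <= branch_sign p <= 1).
    { unfold branch_sign. rewrite opp_IZR. generalize (sgn_range (A1 p * A2 p)). lra. }
    apply Rabs_le. nra.
  - intros idx. apply at_most_two.
    intros x y z ((((Hx & K1x & E1x) & K2x & E2x) & K3x & E3x) & Ix)
      ((((Hy & K1y & E1y) & K2y & E2y) & K3y & E3y) & Iy)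
      ((((Hz & K1z & E1z) & K2z & E2z) & K3z & E3z) & Iz).
    destruct (Hrep x Hx) as (Hq & F1 & F2 & F3).
    rewrite (Hext y x) in K1y, K2y, K3y by congruence.
    rewrite (Hext z x) in K1z, K2z, K3z by congruence.
    set (q := rep x) in *.
    destruct Hx as [Hx []], Hy as [Hy []], Hz as [Hz []], Hq as [Hq []].
    assert (Hk : 0 < k) by (unfold k; lra).
    assert (Hclose : forall u v, up (k * u) = idx -> up (k * v) = idx -> Rabs (u - v) < / k).
    { intros u v Hu Hv. assert (H := up_eq_close _ _ (eq_trans Hu (eq_sym Hv))).
      rewrite <- Rmult_minus_distr_l, Rabs_mult, (Rabs_pos_eq k) in H by lra.
      apply Rmult_lt_reg_l with k; auto. rewrite Rinv_r by lra. auto. }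
    apply close_conic_points with (q := q) (b1 := b1) (b2 := b2) (b3 := b3) (e := / k);
      try (split; congruence); try congruence; auto.
    rewrite !mult_IZR, !Rabs_mult.
    apply Rle_trans with X.
    + fold Y. replace (2048 * Y * (/ k * / k)) with (X * (/ 2)); [lra|].
      assert (EY : Y = rho * rho * X) by (rewrite Hrho2; field; lra).
      rewrite EY. unfold k. field. lra.
    + assert (Q : forall A a, A <> 0%Z -> log4 A = a -> 4 ^ a <= Rabs (IZR A)).
      { intros A a HA <-. apply log4_spec; auto. }
      assert (Q0 : forall n, 0 <= 4 ^ n) by (intros n; generalize (P4 n); lra).
      unfold X. apply Rmult_le_compat; auto; [apply Rmult_le_pos; auto| |apply Q; auto; apply Hq].
      apply Rmult_le_compat; auto; apply Q; auto; apply Hq.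
Qed.

(** * Summation over boxes *)

(** The height condition in the parameters. The bound [2 B], which comes from [|x1 + x2|], is used
    for all three terms so that the conditions are symmetric in the indices; [3 B] comes from
    [|x1 + x2 + x3|]. *)
Record admissible (B : R) (p : param) : Prop := {
  adm_conic : on_conic p;
  adm_d : (0 < pd p)%Z; adm_t : (0 < pt p)%Z;
  adm_A : IZR (pd p) ^ 3 * (Rabs (IZR (A1 p)) * Rabs (IZR (A2 p)) * Rabs (IZR (A3 p))) <= B;
  adm_y : (IZR (s1 p) * IZR (s2 p) * IZR (s3 p)) ^ 2 * IZR (pt p) ^ 3
          * (IZR (y1 p) * IZR (y2 p) * IZR (y3 p)) <= 3 * B;
  adm_x1 : IZR (pd p) * (IZR (s1 p) * IZR (s2 p) * IZR (s3 p)) * IZR (pt p) ^ 2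
           * (IZR (s1 p) * Rabs (IZR (A1 p)) * IZR (y1 p) ^ 2) <= 2 * B;
  adm_x2 : IZR (pd p) * (IZR (s1 p) * IZR (s2 p) * IZR (s3 p)) * IZR (pt p) ^ 2
           * (IZR (s2 p) * Rabs (IZR (A2 p)) * IZR (y2 p) ^ 2) <= 2 * B;
  adm_x3 : IZR (pd p) * (IZR (s1 p) * IZR (s2 p) * IZR (s3 p)) * IZR (pt p) ^ 2
           * (IZR (s3 p) * Rabs (IZR (A3 p)) * IZR (y3 p) ^ 2) <= 2 * B }.

Definition term_size (c : Z) (a b : nat) : R := IZR c * 4 ^ a * 64 ^ b.
Definition size1 (p : param) : R := term_size (s1 p) (log4 (A1 p)) (log8 (y1 p)).
Definition size2 (p : param) : R := term_size (s2 p) (log4 (A2 p)) (log8 (y2 p)).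
Definition size3 (p : param) : R := term_size (s3 p) (log4 (A3 p)) (log8 (y3 p)).
Definition A_size (p : param) : R := 4 ^ log4 (A1 p) * 4 ^ log4 (A2 p) * 4 ^ log4 (A3 p).
Definition y_size (p : param) : R := 8 ^ log8 (y1 p) * 8 ^ log8 (y2 p) * 8 ^ log8 (y3 p).

Ltac pos := repeat first
  [ assumption | lra | apply Rmult_le_pos | apply Rmult_lt_0_compat | apply Rdiv_lt_0_compat
  | apply Rlt_le, Rinv_0_lt_compat | apply Rinv_0_lt_compat | apply pow_lt | apply pow_le
  | (apply Rlt_le; apply exp_pos) | apply exp_pos | apply sqrt_pos ].

Lemma pow64_sq b : 64 ^ b = (8 ^ b) ^ 2.
Proof. rewrite <- pow_mult, Nat.mul_comm, pow_mult. f_equal. ring. Qed.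
Lemma pow4_sq a : 4 ^ a = (2 ^ a) ^ 2.
Proof. rewrite <- pow_mult, Nat.mul_comm, pow_mult. f_equal. ring. Qed.

Lemma term_size_bounds s A y : (0 < s)%Z -> A <> 0%Z -> (0 < y)%Z ->
  term_size s (log4 A) (log8 y) <= IZR s * Rabs (IZR A) * IZR y ^ 2
    <= 256 * term_size s (log4 A) (log8 y).
Proof.
  intros Hs HA Hy. unfold term_size. rewrite pow64_sq.
  destruct (log4_spec A HA) as [LA UA]. destruct (log8_spec y Hy) as [Ly Uy].
  apply IZR_lt in Hs.
  assert (P4 : 0 < 4 ^ log4 A) by pos. assert (P8 : 0 < 8 ^ log8 y) by pos.
  assert (Ly2 : (8 ^ log8 y) ^ 2 <= IZR y ^ 2) by (apply pow_incr; lra).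
  assert (Uy2 : IZR y ^ 2 <= (8 * 8 ^ log8 y) ^ 2) by (apply pow_incr; lra).
  split.
  - apply Rmult_le_compat; pos. apply Rmult_le_compat_l; lra.
  - replace (256 * (IZR s * 4 ^ log4 A * (8 ^ log8 y) ^ 2))
      with (IZR s * (4 * 4 ^ log4 A) * (8 * 8 ^ log8 y) ^ 2) by ring.
    apply Rmult_le_compat; pos; try apply Rabs_pos; try apply Rmult_le_compat_l; try lra.
Qed.

(** The crude bound [4 * B] is common to all variables, so that one logarithm [ln (4 * B)] serves
    everywhere. In [bb_eq] the factor 256 is [4 * 8^2], the loss in passing from a term of the conic
    to its dyadic size. *)
Record box_bounds (B : R) (p : param) : Prop := {
  bb_s1 : 1 <= IZR (s1 p) <= 4 * B; bb_s2 : 1 <= IZR (s2 p) <= 4 * B;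
  bb_s3 : 1 <= IZR (s3 p) <= 4 * B;
  bb_t : 1 <= IZR (pt p) <= 4 * B; bb_d : 1 <= IZR (pd p) <= 4 * B;
  bb_a1 : 4 * 4 ^ log4 (A1 p) <= 4 * B; bb_a2 : 4 * 4 ^ log4 (A2 p) <= 4 * B;
  bb_a3 : 4 * 4 ^ log4 (A3 p) <= 4 * B;
  bb_b1 : 4 ^ log8 (y1 p) <= 4 * B; bb_b2 : 4 ^ log8 (y2 p) <= 4 * B;
  bb_A : IZR (pd p) ^ 3 * A_size p <= B;
  bb_y : (IZR (s1 p) * IZR (s2 p) * IZR (s3 p)) ^ 2 * IZR (pt p) ^ 3 * y_size p <= 3 * B;
  bb_x1 : IZR (pd p) * (IZR (s1 p) * IZR (s2 p) * IZR (s3 p)) * IZR (pt p) ^ 2 * size1 p <= 2 * B;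
  bb_eq : size1 p <= 256 * (size2 p + size3 p) }.

Lemma Rmult_ge1_l a b : 1 <= a -> 1 <= b -> a <= a * b.
Proof. intros. nra. Qed.
Lemma Rmult_ge1 a b : 1 <= a -> 1 <= b -> 1 <= a * b.
Proof. intros. nra. Qed.

Lemma admissible_box_bounds B p : 0 < B -> admissible B p -> box_bounds B p.
Proof.
  intros HB [Hp Hd Ht HA Hy Hx1 Hx2 Hx3].
  destruct Hp as [Ps1 Ps2 Ps3 Py1 Py2 Py3 NA1 NA2 NA3 E _ _ _].
  assert (I : forall z, (0 < z)%Z -> 1 <= IZR z) by (intros; apply IZR_le; lia).
  assert (J : forall z, z <> 0%Z -> 1 <= Rabs (IZR z)).
  { intros z Hz. rewrite <- abs_IZR. apply IZR_le. lia. }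
  assert (K : forall a n, (1 <= n)%nat -> 1 <= a -> a <= a ^ n).
  { intros a n Hn Ha. rewrite <- (pow_1 a) at 1. apply Rle_pow; auto. }
  destruct (log4_spec _ NA1) as [LA1 _], (log4_spec _ NA2) as [LA2 _], (log4_spec _ NA3) as [LA3 _].
  destruct (log8_spec _ Py1) as [Ly1 _], (log8_spec _ Py2) as [Ly2 _], (log8_spec _ Py3) as [Ly3 _].
  destruct (term_size_bounds _ _ _ Ps1 NA1 Py1) as [L1 _].
  destruct (term_size_bounds _ _ _ Ps1 NA1 Py1) as [_ U1].
  destruct (term_size_bounds _ _ _ Ps2 NA2 Py2) as [_ U2].
  destruct (term_size_bounds _ _ _ Ps3 NA3 Py3) as [_ U3].
  assert (D := I _ Hd). assert (T := I _ Ht). assert (S1 := I _ Ps1). assert (S2 := I _ Ps2).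
  assert (S3 := I _ Ps3). assert (Y1 := I _ Py1). assert (Y2 := I _ Py2). assert (Y3 := I _ Py3).
  assert (M1 := J _ NA1). assert (M2 := J _ NA2). assert (M3 := J _ NA3).
  assert (Eq : IZR (s1 p) * Rabs (IZR (A1 p)) * IZR (y1 p) ^ 2 <=
     IZR (s2 p) * Rabs (IZR (A2 p)) * IZR (y2 p) ^ 2 + IZR (s3 p) * Rabs (IZR (A3 p)) * IZR (y3 p) ^ 2).
  { apply (f_equal IZR) in E. rewrite !plus_IZR, !mult_IZR, !Z.pow_2_r, !mult_IZR in E.
    assert (W : forall s A y, 1 <= s -> 1 <= y -> s * Rabs A * y ^ 2 = Rabs (s * A * (y * y))).
    { intros s A y Hs Hy1. rewrite !Rabs_mult, (Rabs_pos_eq s), (Rabs_pos_eq y) by lra. ring. }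
    rewrite !W by auto.
    replace (IZR (s1 p) * IZR (A1 p) * (IZR (y1 p) * IZR (y1 p))) with
     (- (IZR (s2 p) * IZR (A2 p) * (IZR (y2 p) * IZR (y2 p)) + IZR (s3 p) * IZR (A3 p) * (IZR (y3 p) * IZR (y3 p))))
     by lra.
    rewrite Rabs_Ropp. apply Rabs_triang. }
  clear E I J.
  set (d := IZR (pd p)) in *. set (tt := IZR (pt p)) in *. set (u1 := IZR (s1 p)) in *.
  set (u2 := IZR (s2 p)) in *. set (u3 := IZR (s3 p)) in *.
  set (z1 := IZR (y1 p)) in *. set (z2 := IZR (y2 p)) in *. set (z3 := IZR (y3 p)) in *.
  set (m1 := Rabs (IZR (A1 p))) in *. set (m2 := Rabs (IZR (A2 p))) in *.
  set (m3 := Rabs (IZR (A3 p))) in *.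
  assert (Hm : d <= B /\ m1 <= B /\ m2 <= B /\ m3 <= B).
  { assert (d <= d ^ 3) by (apply K; auto; lia). assert (1 <= d ^ 3) by lra.
    assert (G2 := Rmult_ge1 _ _ M1 M2). assert (G3 := Rmult_ge1_l _ _ G2 M3).
    assert (G4 := Rmult_ge1_l _ _ M1 M2). assert (G5 := Rmult_ge1_l _ _ M2 M1).
    assert (G6 := Rmult_ge1_l _ _ M3 G2).
    assert (G7 : m1 * m2 * m3 <= d ^ 3 * (m1 * m2 * m3)).
    { rewrite (Rmult_comm (d ^ 3)). apply Rmult_ge1_l; lra. }
    assert (G8 : d ^ 3 <= d ^ 3 * (m1 * m2 * m3)) by (apply Rmult_ge1_l; lra).
    repeat split; lra. }
  assert (Hs : u1 <= 3 * B /\ u2 <= 3 * B /\ u3 <= 3 * B /\ tt <= 3 * B /\ z1 <= 3 * B /\ z2 <= 3 * B).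
  { assert (G12 := Rmult_ge1 _ _ S1 S2). assert (G := Rmult_ge1_l _ _ G12 S3).
    assert (Gs : u1 * u2 * u3 <= (u1 * u2 * u3) ^ 2) by (apply K; [lia|lra]).
    assert (Gt : tt <= tt ^ 3) by (apply K; [lia|lra]).
    assert (H12 := Rmult_ge1 _ _ Y1 Y2). assert (H := Rmult_ge1_l _ _ H12 Y3).
    set (S := (u1 * u2 * u3) ^ 2) in *. set (TT := tt ^ 3) in *. set (Z := z1 * z2 * z3) in *.
    assert (Q0 : 1 <= S * TT) by (apply Rmult_ge1; lra).
    assert (Q1 : S <= S * TT) by (apply Rmult_ge1_l; lra).
    assert (Q2 : TT <= S * TT) by (rewrite Rmult_comm; apply Rmult_ge1_l; lra).
    assert (Q3 : S * TT <= S * TT * Z) by (apply Rmult_ge1_l; lra).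
    assert (Q4 : Z <= S * TT * Z) by (rewrite (Rmult_comm _ Z); apply Rmult_ge1_l; lra).
    assert (V1 := Rmult_ge1_l _ _ S1 S2). assert (V2 := Rmult_ge1_l _ _ S2 S1).
    assert (V3 := Rmult_ge1_l _ _ S3 G12).
    assert (V4 := Rmult_ge1_l _ _ Y1 Y2). assert (V5 := Rmult_ge1_l _ _ Y2 Y1).
    repeat split; lra. }
  assert (P4 : forall n, 0 < 4 ^ n) by (intros; pos).
  assert (P8 : forall n, 0 < 8 ^ n) by (intros; pos).
  assert (P48 : forall n, 4 ^ n <= 8 ^ n) by (intros; apply pow_incr; lra).
  assert (PP : 0 < d * (u1 * u2 * u3) * tt ^ 2) by (pos; apply Rlt_le_trans with 1; lra).
  subst d tt u1 u2 u3 z1 z2 z3 m1 m2 m3.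
  constructor; try lra.
  - apply Rle_trans with (8 ^ log8 (y1 p)); auto. lra.
  - apply Rle_trans with (8 ^ log8 (y2 p)); auto. lra.
  - apply Rle_trans with (2 := HA). apply Rmult_le_compat_l; [apply pow_le; lra|].
    unfold A_size. apply Rmult_le_compat; auto; [apply Rmult_le_pos; apply Rlt_le; auto|apply Rlt_le; auto|].
    apply Rmult_le_compat; auto; apply Rlt_le; auto.
  - apply Rle_trans with (2 := Hy). apply Rmult_le_compat_l.
    { apply Rmult_le_pos; apply pow_le; [repeat apply Rmult_le_pos; lra|lra]. }
    unfold y_size. apply Rmult_le_compat; auto; [apply Rmult_le_pos; apply Rlt_le; auto|apply Rlt_le; auto|].
    apply Rmult_le_compat; auto; apply Rlt_le; auto.
  - apply Rle_trans with (2 := Hx1). apply Rmult_le_compat_l; [lra|auto].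
  - unfold size1, size2, size3. lra.
Qed.

Lemma Rsq_le_le x y : 0 <= x -> 0 <= y -> x ^ 2 <= y ^ 2 -> x <= y.
Proof.
  intros Hx Hy H. apply Rsqr_incr_0; auto. unfold Rsqr. lra.
Qed.

Lemma Rle_div_r_of_mul a b c : 0 < b -> a * b <= c -> a <= c / b.
Proof.
  intros Hb H. apply Rmult_le_reg_r with b; auto. unfold Rdiv.
  rewrite Rmult_assoc, Rinv_l by lra. lra.
Qed.

Definition leading1 (p : param) : Prop := size2 p <= size1 p /\ size3 p <= size1 p.

(** Here the bound per box is [2 * 196608] times [X Y / Z1]. It is summed over [y3] and [y2] up to
    [Z1], over [y1] by the height of [x1], and over [A3] by the height of [x4]. The logarithms come
    from [s1], [s2], [s3], [t], [A1] and [A2]. *)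
Lemma at_most_many_lattice_points B :
  1 <= B ->
  at_most (fun p => (admissible B p /\ leading1 p) /\ size1 p <= A_size p)
    (50331648 * B * (1 + ln (4 * B)) ^ 6).
Proof.
  intros HB.
  set (G := fun p => (admissible B p /\ leading1 p) /\ size1 p <= A_size p).
  assert (HG : forall p, G p -> box_bounds B p).
  { intros p [[Hp _] _]. apply admissible_box_bounds; auto. lra. }
  assert (HL : 0 <= ln (4 * B)) by (apply ln_nonneg; lra).
  set (L := 1 + ln (4 * B)).
  assert (HL1 : 1 <= L) by (unfold L; lra).
  assert (Hinv : forall n, (1 <= n)%Z -> 0 < IZR n /\ 0 < / IZR n /\ 1 <= IZR n).
  { intros n Hn. apply IZR_le in Hn. split; [lra|]. split; [apply Rinv_0_lt_compat; lra|lra]. }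
  set (C := 12582912 * B).
  assert (HC : 0 <= C) by (unfold C; lra).
  replace (50331648 * B * L ^ 6) with (C * L ^ 2 * 4 * L * L * L * L) by (unfold C; ring).
  apply at_most_fiber_harmonic with (f := s1) (N := 4 * B); [pos|lra|intros p Hp; apply HG; auto|].
  intros c1 Hc1. destruct (Hinv c1 Hc1) as (Pc1 & Ic1 & _).
  replace (C * L ^ 2 * 4 * L * L * L * / IZR c1) with (C * L ^ 2 * / IZR c1 * 4 * L * L * L) by ring.
  apply at_most_fiber_harmonic with (f := s2) (N := 4 * B); [pos|lra|intros p [Hp _]; apply HG; auto|].
  intros c2 Hc2. destruct (Hinv c2 Hc2) as (Pc2 & Ic2 & _).
  match goal with |- at_most _ ?r => replace r with
    (C * L ^ 2 * / IZR c1 * / IZR c2 * 4 * L * L) by ring end.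
  apply at_most_fiber_harmonic with (f := s3) (N := 4 * B); [pos|lra|intros p [[Hp _] _]; apply HG; auto|].
  intros c3 Hc3. destruct (Hinv c3 Hc3) as (Pc3 & Ic3 & _).
  match goal with |- at_most _ ?r => replace r with
    (C * L ^ 2 * / IZR c1 * / IZR c2 * / IZR c3 * 4 * L) by ring end.
  apply at_most_fiber_harmonic with (f := pt) (N := 4 * B); [pos|lra|intros p [[[Hp _] _] _]; apply HG; auto|].
  intros t Ht. destruct (Hinv t Ht) as (Pt & It & _).
  match goal with |- at_most _ ?r => replace r with
    (C * L ^ 2 * / IZR c1 * / IZR c2 * / IZR c3 * / IZR t * 4) by ring end.
  apply at_most_fiber_zeta with (f := pd) (N := 4 * B); [pos|intros p [[[[Hp _] _] _] _]; apply HG; auto|].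
  intros d Hd. destruct (Hinv d Hd) as (Pd & Id & Gd).
  set (E := C * / IZR c1 * / IZR c2 * / IZR c3 * / IZR t * / IZR d ^ 2).
  assert (Pinv : 0 < / IZR d ^ 2) by pos.
  assert (PE : 0 <= E) by (unfold E; pos).
  (* The sum over [d] has exponent 2, which is weakened to 4/3 to reuse the zeta bound. *)
  apply at_most_le with (L * (L * E)).
  { replace (L * (L * E)) with (C * L ^ 2 * / IZR c1 * / IZR c2 * / IZR c3 * / IZR t * / IZR d ^ 2)
      by (unfold E; ring).
    apply Rmult_le_compat_l; [pos|].
    assert (K := cbrt_pos (IZR d)).
    apply Rinv_le_contravar; [pos|]. simpl. apply Rmult_le_compat_l; [lra|]. rewrite Rmult_1_r.
    apply cbrt_le_id; auto. }
  apply at_most_fiber_log with (f := fun p => log4 (A1 p)); [pos|lra| |].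
  { intros p [[[[[Hp _] _] _] _] _]. assert (H := bb_a1 B p (HG p Hp)).
    apply Rle_trans with (2 := H). generalize (pow_lt 4 (log4 (A1 p))). lra. }
  intros a1.
  apply at_most_fiber_log with (f := fun p => log4 (A2 p)); [pos|lra| |].
  { intros p [[[[[[Hp _] _] _] _] _] _]. assert (H := bb_a2 B p (HG p Hp)).
    apply Rle_trans with (2 := H). generalize (pow_lt 4 (log4 (A2 p))). lra. }
  intros a2.
  assert (Sq : forall x, 0 < x -> 0 < sqrt x /\ x = sqrt x ^ 2).
  { intros x Hx. split; [apply sqrt_lt_R0; auto|]. symmetry. apply pow2_sqrt. lra. }
  destruct (Sq B) as (Pq & Eq); [lra|]. destruct (Sq _ Pc1) as (Pr1 & Er1).
  destruct (Sq _ Pc2) as (Pr2 & Er2). destruct (Sq _ Pc3) as (Pr3 & Er3).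
  destruct (Sq _ Pd) as (Pe & Ee).
  set (q := sqrt B) in *. set (r1 := sqrt (IZR c1)) in *. set (r2 := sqrt (IZR c2)) in *.
  set (r3 := sqrt (IZR c3)) in *. set (e := sqrt (IZR d)) in *.
  clearbody q r1 r2 r3 e.
  assert (P2 : forall n, 0 < 2 ^ n) by (intros; pos).
  assert (P8 : forall n, 0 < 8 ^ n) by (intros; pos).
  (* From here on each [replace] splits the bound as [c * (2 * Q)], where [Q] is the largest value
     of the next power, given the variables already fixed. For [y1], [sqrt(2 B)] is enlarged to
     [2 sqrt(B)]. *)
  replace E with (6291456 * q * 2 ^ a1 * 2 ^ a2 / (e * r1 ^ 2 * r2 ^ 2 * r3 ^ 2 * IZR t) *
     (2 * (q / (e ^ 3 * 2 ^ a1 * 2 ^ a2)))).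
  2:{ unfold E, C. rewrite Er1, Er2, Er3, Ee, Eq. field.
      repeat split; apply Rgt_not_eq, Rlt_gt; auto. }
  apply at_most_fiber_geom with (f := fun p => log4 (A3 p)) (b := 2); [lra|pos|pos| |].
  { intros p (((((((Hp & E1) & E2) & E3) & Et) & Ed) & Ea1) & Ea2).
    assert (H := bb_A B p (HG p Hp)). apply Rle_div_r_of_mul; [pos|].
    apply Rsq_le_le; [pos|pos|]. rewrite <- Eq. apply Rle_trans with (2 := H).
    unfold A_size. rewrite !pow4_sq, Ea1, Ea2, Ed, Ee. apply Req_le. ring. }
  intros a3.
  replace (6291456 * q * 2 ^ a1 * 2 ^ a2 / (e * r1 ^ 2 * r2 ^ 2 * r3 ^ 2 * IZR t) * 2 ^ a3)
    with (1572864 * 2 ^ a2 * 2 ^ a3 * 4 ^ a1 / (r2 * r3) *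
      (2 * (2 * q / (e * r1 * r2 * r3 * IZR t * r1 * 2 ^ a1)))).
  2:{ rewrite pow4_sq. field. repeat split; apply Rgt_not_eq, Rlt_gt; auto. }
  apply at_most_fiber_geom with (f := fun p => log8 (y1 p)) (b := 8); [lra|pos|pos| |].
  { intros p ((((((((Hp & E1) & E2) & E3) & Et) & Ed) & Ea1) & Ea2) & Ea3).
    assert (H := bb_x1 B p (HG p Hp)). apply Rle_div_r_of_mul; [pos|].
    apply Rsq_le_le; [pos|pos|]. apply Rle_trans with (2 * B); [|rewrite Eq; generalize (pow_lt q 2 Pq); lra].
    apply Rle_trans with (2 := H).
    unfold size1, term_size. rewrite !pow4_sq, pow64_sq, E1, E2, E3, Ea1, Ed, Et, Er1, Er2, Er3, Ee.
    apply Req_le. ring. }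
  intros b1.
  replace (1572864 * 2 ^ a2 * 2 ^ a3 * 4 ^ a1 / (r2 * r3) * 8 ^ b1) with
    (786432 * 4 ^ a2 * 2 ^ a3 * 2 ^ a1 / (r1 * r3) * (2 * (8 ^ b1 * 2 ^ a1 * r1 / (2 ^ a2 * r2)))).
  2:{ rewrite !pow4_sq. field. repeat split; apply Rgt_not_eq, Rlt_gt; auto. }
  apply at_most_fiber_geom with (f := fun p => log8 (y2 p)) (b := 8); [lra|pos|pos| |].
  { intros p (((((((((Hp & E1) & E2) & E3) & Et) & Ed) & Ea1) & Ea2) & Ea3) & Eb1).
    apply Rle_div_r_of_mul; [pos|]. apply Rsq_le_le; [pos|pos|].
    destruct Hp as [[_ [Hs _]] _]. unfold size1, size2, term_size in Hs.
    rewrite !pow4_sq, !pow64_sq, E1, E2, Ea1, Ea2, Eb1, Er1, Er2 in Hs. lra. }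
  intros b2.
  replace (786432 * 4 ^ a2 * 2 ^ a3 * 2 ^ a1 / (r1 * r3) * 8 ^ b2) with
    (393216 * 4 ^ a2 * 4 ^ a3 * 8 ^ b2 / (r1 ^ 2 * 8 ^ b1) * (2 * (8 ^ b1 * 2 ^ a1 * r1 / (2 ^ a3 * r3)))).
  2:{ rewrite !pow4_sq. field. repeat split; apply Rgt_not_eq, Rlt_gt; auto. }
  apply at_most_fiber_geom with (f := fun p => log8 (y3 p)) (b := 8); [lra|pos|pos| |].
  { intros p ((((((((((Hp & E1) & E2) & E3) & Et) & Ed) & Ea1) & Ea2) & Ea3) & Eb1) & Eb2).
    apply Rle_div_r_of_mul; [pos|]. apply Rsq_le_le; [pos|pos|].
    destruct Hp as [[_ [_ Hs]] _]. unfold size1, size3, term_size in Hs.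
    rewrite !pow4_sq, !pow64_sq, E1, E3, Ea1, Ea3, Eb1, Er1, Er3 in Hs. lra. }
  intros b3.
  apply at_most_inhabited; [pos|].
  intros p (((((((((((Hp & E1) & E2) & E3) & Et) & Ed) & Ea1) & Ea2) & Ea3) & Eb1) & Eb2) & Eb3).
  destruct Hp as [_ Hs]. unfold size1, A_size, term_size in Hs.
  rewrite E1, Ea1, Ea2, Ea3, Eb1 in Hs.
  clear p E1 E2 E3 Et Ed Ea1 Ea2 Ea3 Eb1 Eb2 Eb3.
  apply at_most_le with
    (196608 * (8 ^ b1 * 8 ^ b2 * 8 ^ b3) * (1 + 4 ^ a2 * 4 ^ a3 / (IZR c1 * 64 ^ b1))).
  - assert (H1 : 1 <= 4 ^ a2 * 4 ^ a3 / (IZR c1 * 64 ^ b1)).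
    { apply Rle_div_r_of_mul; [pos|]. apply Rmult_le_reg_l with (4 ^ a1); [pos|]. lra. }
    apply Rle_trans with (196608 * (8 ^ b1 * 8 ^ b2 * 8 ^ b3) *
      (2 * (4 ^ a2 * 4 ^ a3 / (IZR c1 * 64 ^ b1)))).
    + apply Rmult_le_compat_l; [pos|lra].
    + rewrite <- Er1, pow64_sq. apply Req_le. field. split; apply Rgt_not_eq, Rlt_gt; auto.
  - apply at_most_impl with (2 := at_most_linear_box d t c1 c2 c3 a1 a2 a3 b1 b2 b3 ltac:(lia)).
    intros p (((((((((((Hp & E1) & E2) & E3) & Et) & Ed) & Ea1) & Ea2) & Ea3) & Eb1) & Eb2) & Eb3).
    split; [apply Hp|]. split; auto.
Qed.

Lemma cube_le x y : 0 <= y -> x ^ 3 <= y ^ 3 -> x <= y.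
Proof.
  intros Hy H. destruct (Rle_lt_dec x y) as [|L]; auto. exfalso.
  assert (y ^ 3 < x ^ 3).
  { assert (y * y < x * x) by (apply Rmult_le_0_lt_compat; lra).
    replace (y ^ 3) with (y * y * y) by ring. replace (x ^ 3) with (x * x * x) by ring.
    apply Rmult_le_0_lt_compat; try lra. apply Rmult_le_pos; lra. }
  lra.
Qed.

Lemma pow8_cube b : 8 ^ b = (2 ^ b) ^ 3.
Proof. rewrite <- pow_mult, Nat.mul_comm, pow_mult. f_equal. ring. Qed.

(* The two bounds [Y] and [L^3 sqrt(X Y)] are interpolated with weights 1/3 and 2/3;
   [x^3 = X] and [y^3 = Y]. *)
Lemma at_most_thin_box d t c1 c2 c3 a1 a2 a3 b1 b2 b3 N x :
  4 * 4 ^ a1 <= N -> 4 * 4 ^ a2 <= N -> 4 * 4 ^ a3 <= N ->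
  0 < x -> 4 ^ a1 * 4 ^ a2 * 4 ^ a3 = x ^ 3 -> (0 < c1)%Z ->
  4 ^ a1 * 4 ^ a2 * 4 ^ a3 <= term_size c1 a1 b1 ->
  at_most (fun p => on_conic p /\ in_box d t c1 c2 c3 a1 a2 a3 b1 b2 b3 p)
    (7084800 * (1 + ln N) ^ 2 * (x * (4 ^ b1 * 4 ^ b2 * 4 ^ b3))).
Proof.
  intros N1 N2 N3 Hx EX Hc1 Hthin.
  assert (HL : 0 <= ln N).
  { apply ln_nonneg. generalize (pow_R1_Rle 4 a1). lra. }
  set (L := 1 + ln N). assert (HL1 : 1 <= L) by (unfold L; lra).
  set (y := 2 ^ b1 * 2 ^ b2 * 2 ^ b3).
  assert (Hy : 0 < y) by (unfold y; pos).
  assert (EY : 8 ^ b1 * 8 ^ b2 * 8 ^ b3 = y ^ 3) by (unfold y; rewrite !pow8_cube; ring).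
  replace (4 ^ b1 * 4 ^ b2 * 4 ^ b3) with (y ^ 2) by (unfold y; rewrite !pow4_sq; ring).
  (* The bound for fixed [y]: the hypothesis [X <= Z1] makes its fraction at most 1, and
     [2 * 196608 <= 7084800]. *)
  assert (TY : y ^ 3 <= L ^ 2 * (x * y ^ 2) ->
    at_most (fun p => on_conic p /\ in_box d t c1 c2 c3 a1 a2 a3 b1 b2 b3 p)
      (7084800 * L ^ 2 * (x * y ^ 2))).
  { intros H. apply at_most_le with (2 := at_most_linear_box d t c1 c2 c3 a1 a2 a3 b1 b2 b3 Hc1).
    rewrite EY.
    assert (Hc : 0 < IZR c1) by (apply IZR_lt; auto).
    assert (H1 : 4 ^ a2 * 4 ^ a3 / (IZR c1 * 64 ^ b1) <= 1).
    { apply Rmult_le_reg_r with (4 ^ a1 * (IZR c1 * 64 ^ b1)); [pos|].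
      unfold term_size in Hthin.
      replace (4 ^ a2 * 4 ^ a3 / (IZR c1 * 64 ^ b1) * (4 ^ a1 * (IZR c1 * 64 ^ b1)))
        with (4 ^ a1 * 4 ^ a2 * 4 ^ a3); [lra|].
      field. split; apply Rgt_not_eq, Rlt_gt; pos. }
    assert (Hy3 : 0 < y ^ 3) by pos.
    apply Rle_trans with (196608 * y ^ 3 * 2); [apply Rmult_le_compat_l; lra|]. lra. }
  assert (L2 : 1 <= L ^ 2) by (apply pow_R1_Rle; auto).
  assert (Hy2 : 0 < y ^ 2) by pos.
  destruct (Rle_lt_dec y x) as [Hxy|Hxy].
  { apply TY. assert (y ^ 3 <= x * y ^ 2).
    { replace (y ^ 3) with (y * y ^ 2) by ring. apply Rmult_le_compat_r; lra. }
    assert (0 < x * y ^ 2) by pos. nra. }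
  assert (HXY : x ^ 3 <= y ^ 3) by (apply pow_incr; lra).
  set (rho := sqrt (y ^ 3 / x ^ 3)).
  assert (Hx3 : 0 < x ^ 3) by pos.
  assert (Hrho : 0 < rho) by (apply sqrt_lt_R0; pos).
  assert (Hrho2 : rho ^ 2 = y ^ 3 / x ^ 3) by (apply pow2_sqrt; pos).
  destruct (Rle_lt_dec (L * (x ^ 3 * rho)) (x * y ^ 2)) as [H|H].
  - apply at_most_le with (2 := at_most_conic_box d t c1 c2 c3 a1 a2 a3 b1 b2 b3 N N1 N2 N3
      ltac:(rewrite EX, EY; auto)).
    rewrite EX, EY. fold L rho. replace (7084800 * L ^ 3 * (x ^ 3 * rho)) with
      (7084800 * L ^ 2 * (L * (x ^ 3 * rho))) by ring.
    apply Rmult_le_compat_l; lra.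
  (* Squaring [x y^2 < L x^(3/2) y^(3/2)] gives [y < L^2 x], that is [Y < L^2 x y^2]. *)
  - apply TY.
    assert (Hsq : (x * y ^ 2) ^ 2 < (L * (x ^ 3 * rho)) ^ 2).
    { assert (0 < x * y ^ 2) by pos.
      replace ((x * y ^ 2) ^ 2) with ((x * y ^ 2) * (x * y ^ 2)) by ring.
      replace ((L * (x ^ 3 * rho)) ^ 2) with ((L * (x ^ 3 * rho)) * (L * (x ^ 3 * rho))) by ring.
      apply Rmult_le_0_lt_compat; lra. }
    assert (E : (L * (x ^ 3 * rho)) ^ 2 = (L ^ 2 * x) * (x ^ 2 * y ^ 3)).
    { replace ((L * (x ^ 3 * rho)) ^ 2) with (L ^ 2 * (x ^ 3) ^ 2 * rho ^ 2) by ring.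
      rewrite Hrho2. field. lra. }
    rewrite E in Hsq. replace ((x * y ^ 2) ^ 2) with (y * (x ^ 2 * y ^ 3)) in Hsq by ring.
    apply Rmult_lt_reg_r in Hsq; [|pos].
    replace (y ^ 3) with (y * y ^ 2) by ring. rewrite <- Rmult_assoc.
    apply Rmult_le_compat_r; lra.
Qed.

(** The six logarithms are two from [at_most_thin_box] and one each from [y1], [y2], [A2], [A3]. The
    constant is [7084800 * 11 * 2 * 3 * 4^4]: 11 values for the size of [A1], the geometric sum over
    [y3], the [3 B] in the bound for [y], and four zeta sums. *)
Lemma at_most_few_lattice_points B :
  1 <= B ->
  at_most (fun p => (admissible B p /\ leading1 p) /\ A_size p <= size1 p)
    (119704780800 * B * (1 + ln (4 * B)) ^ 6).
Proof.
  intros HB.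
  set (G := fun p => (admissible B p /\ leading1 p) /\ A_size p <= size1 p).
  assert (HG : forall p, G p -> box_bounds B p).
  { intros p [[Hp _] _]. apply admissible_box_bounds; auto. lra. }
  assert (HL : 0 <= ln (4 * B)) by (apply ln_nonneg; lra).
  set (L := 1 + ln (4 * B)).
  assert (HL1 : 1 <= L) by (unfold L; lra).
  assert (Hcb : forall n, (1 <= n)%Z -> 0 < IZR n /\ 0 < cbrt (IZR n) /\ IZR n = cbrt (IZR n) ^ 3
    /\ 0 < / (IZR n * cbrt (IZR n))).
  { intros n Hn. apply IZR_le in Hn. assert (0 < IZR n) by lra. assert (K := cbrt_pos (IZR n)).
    split; auto. split; auto. split; [apply cbrt_cube; auto|]. pos. }
  set (C := 7084800 * 11 * 2 * 3 * B * L ^ 6).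
  assert (HC : 0 <= C) by (unfold C; pos).
  replace (119704780800 * B * L ^ 6) with (C * 4 * 4 * 4 * 4) by (unfold C; ring).
  apply at_most_fiber_zeta with (f := s1) (N := 4 * B); [pos|intros p Hp; apply HG; auto|].
  intros c1 Hc1. destruct (Hcb c1 Hc1) as (Pc1 & Pr1 & Er1 & Ic1).
  set (i1 := / (IZR c1 * cbrt (IZR c1))) in *.
  replace (C * 4 * 4 * 4 * i1) with (C * i1 * 4 * 4 * 4) by ring.
  apply at_most_fiber_zeta with (f := s2) (N := 4 * B); [pos|intros p [Hp _]; apply HG; auto|].
  intros c2 Hc2. destruct (Hcb c2 Hc2) as (Pc2 & Pr2 & Er2 & Ic2).
  set (i2 := / (IZR c2 * cbrt (IZR c2))) in *.
  replace (C * i1 * 4 * 4 * i2) with (C * i1 * i2 * 4 * 4) by ring.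
  apply at_most_fiber_zeta with (f := s3) (N := 4 * B); [pos|intros p [[Hp _] _]; apply HG; auto|].
  intros c3 Hc3. destruct (Hcb c3 Hc3) as (Pc3 & Pr3 & Er3 & Ic3).
  set (i3 := / (IZR c3 * cbrt (IZR c3))) in *.
  replace (C * i1 * i2 * 4 * i3) with (C * i1 * i2 * i3 * 4) by ring.
  apply at_most_fiber_zeta with (f := pt) (N := 4 * B); [pos|intros p [[[Hp _] _] _]; apply HG; auto|].
  intros t Ht. destruct (Hcb t Ht) as (Pt & Prt & Ert & _).
  assert (Gt : 1 <= IZR t) by (apply IZR_le; auto).
  assert (HtC : / IZR t ^ 2 <= / (IZR t * cbrt (IZR t))).
  { apply Rinv_le_contravar; [pos|]. simpl. apply Rmult_le_compat_l; [lra|]. rewrite Rmult_1_r.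
    apply cbrt_le_id; auto. }
  apply at_most_le with (C * i1 * i2 * i3 * / IZR t ^ 2).
  { apply Rmult_le_compat_l; [pos|auto]. }
  clear HtC Hcb.
  assert (CB := cbrt_cube B ltac:(lra)). assert (CB' := cbrt_cube (3 * B) ltac:(lra)).
  assert (PB := cbrt_pos B). assert (PB' := cbrt_pos (3 * B)).
  unfold i1, i2, i3 in *. clear i1 i2 i3.
  set (r1 := cbrt (IZR c1)) in *. set (r2 := cbrt (IZR c2)) in *. set (r3 := cbrt (IZR c3)) in *.
  set (be := cbrt B) in *. set (be' := cbrt (3 * B)) in *.
  clearbody r1 r2 r3 be be'.
  assert (Hbe : be <= be').
  { apply cube_le; lra. }
  set (U := 7084800 * L ^ 2 * 11 * be).
  assert (PU : 0 <= U) by (unfold U; pos).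
  (* [V] is [(s1 s2 s3)^(4/3) t^2], the power 2/3 of the factor in front of [Y] in [bb_y]. *)
  set (V := r1 ^ 4 * r2 ^ 4 * r3 ^ 4 * IZR t ^ 2).
  assert (PV : 0 < V) by (unfold V; pos).
  set (W := L * (L * (U * (2 * (be' ^ 2 / V))))).
  assert (PW : 0 <= W) by (unfold W; pos).
  apply at_most_le with (L * (L * W)).
  { replace (L * (L * W)) with (7084800 * 11 * 2 * L ^ 6 * (be * be' ^ 2) * / V)
      by (unfold W, U; field; lra).
    replace (C * / (IZR c1 * r1) * / (IZR c2 * r2) * / (IZR c3 * r3) * / IZR t ^ 2)
      with (7084800 * 11 * 2 * L ^ 6 * (3 * B) * / V).
    2:{ unfold C, V. rewrite Er1, Er2, Er3. field. repeat split; apply Rgt_not_eq, Rlt_gt; auto. }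
    apply Rmult_le_compat_r; [pos|]. apply Rmult_le_compat_l; [pos|].
    rewrite CB'. replace (be' ^ 3) with (be' * be' ^ 2) by ring.
    apply Rmult_le_compat_r; [pos|auto]. }
  apply at_most_fiber_log with (f := fun p => log8 (y1 p)); [pos|lra| |].
  { intros p [[[[Hp _] _] _] _]. apply (bb_b1 B p (HG p Hp)). }
  intros b1.
  apply at_most_fiber_log with (f := fun p => log8 (y2 p)); [pos|lra| |].
  { intros p [[[[[Hp _] _] _] _] _]. apply (bb_b2 B p (HG p Hp)). }
  intros b2.
  assert (P4 : forall n, 0 < 4 ^ n) by (intros; pos).
  assert (P2 : forall n, 0 < 2 ^ n) by (intros; pos).
  replace W with (L * (L * (U * (4 ^ b1 * 4 ^ b2))) * (2 * (be' ^ 2 / (V * 4 ^ b1 * 4 ^ b2)))).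
  2:{ unfold W. field. repeat split; apply Rgt_not_eq, Rlt_gt; auto. }
  apply at_most_fiber_geom with (f := fun p => log8 (y3 p)) (b := 4); [lra|pos|pos| |].
  { intros p ((((((Hp & E1) & E2) & E3) & Et) & Eb1) & Eb2).
    assert (Hy := bb_y B p (HG p Hp)). unfold y_size in Hy.
    rewrite E1, E2, E3, Et, Eb1, Eb2, Er1, Er2, Er3, !pow8_cube, CB' in Hy.
    apply Rle_div_r_of_mul; [pos|].
    replace (4 ^ log8 (y3 p) * (V * 4 ^ b1 * 4 ^ b2)) with
      ((r1 ^ 2 * r2 ^ 2 * r3 ^ 2 * IZR t * (2 ^ b1 * 2 ^ b2 * 2 ^ log8 (y3 p))) ^ 2)
      by (unfold V; rewrite !pow4_sq; ring).
    apply pow_incr. split; [pos|]. apply cube_le; [lra|].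
    apply Rle_trans with (2 := Hy). apply Req_le. ring. }
  intros b3.
  replace (L * (L * (U * (4 ^ b1 * 4 ^ b2))) * 4 ^ b3) with
    (L * (L * (U * (4 ^ b1 * 4 ^ b2 * 4 ^ b3)))) by ring.
  apply at_most_fiber_log with (f := fun p => log4 (A2 p)); [pos|lra| |].
  { intros p (((((((Hp & _) & _) & _) & _) & _) & _) & _).
    assert (H := bb_a2 B p (HG p Hp)). generalize (P4 (log4 (A2 p))). lra. }
  intros a2.
  apply at_most_fiber_log with (f := fun p => log4 (A3 p)); [pos|lra| |].
  { intros p ((((((((Hp & _) & _) & _) & _) & _) & _) & _) & _).
    assert (H := bb_a3 B p (HG p Hp)). generalize (P4 (log4 (A3 p))). lra. }
  intros a3.
  (* Two possible values of [log4 (A1 p)] differ by at most 5, since [512 < 4^5]; this leaves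
     [11 = 2 * 5 + 1] of them. *)
  replace (U * (4 ^ b1 * 4 ^ b2 * 4 ^ b3)) with
    ((2 * INR 5 + 1) * (7084800 * L ^ 2 * be * (4 ^ b1 * 4 ^ b2 * 4 ^ b3)))
    by (unfold U; simpl; ring).
  apply at_most_fiber_bounded with (f := fun p => log4 (A1 p)); [pos| |].
  { (* The largest term of the conic equation is comparable to the second largest, which is fixed. *)
    intros p p' (((((((((Hp & E1) & E2) & E3) & Et) & Eb1) & Eb2) & Eb3) & Ea2) & Ea3)
      (((((((((Hp' & E1') & E2') & E3') & Et') & Eb1') & Eb2') & Eb3') & Ea2') & Ea3').
    assert (H := bb_eq B p (HG p Hp)). destruct Hp' as [[_ [H2 H3]] _].
    unfold size1, size2, size3 in *.
    rewrite E1, E2, E3, Eb1, Eb2, Eb3, Ea2, Ea3 in H.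
    rewrite E1', E2', Eb1', Eb2', Ea2' in H2. rewrite E1', E3', Eb1', Eb3', Ea3' in H3.
    assert (H512 : term_size c1 (log4 (A1 p)) b1 <= 512 * term_size c1 (log4 (A1 p')) b1) by lra.
    unfold term_size in H512.
    assert (Q : 4 ^ log4 (A1 p) <= 4 ^ (log4 (A1 p') + 5)).
    { apply Rmult_le_reg_r with (IZR c1 * 64 ^ b1); [pos|].
      rewrite pow_add. assert (0 < 4 ^ log4 (A1 p') * (IZR c1 * 64 ^ b1)) by pos. simpl (4 ^ 5). lra. }
    destruct (Nat.le_gt_cases (log4 (A1 p)) (log4 (A1 p') + 5)) as [|F]; auto.
    exfalso. assert (4 ^ (log4 (A1 p') + 5) < 4 ^ log4 (A1 p)) by (apply Rlt_pow; [lra|auto]).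
    lra. }
  intros a1.
  assert (PX : 0 < 4 ^ a1 * 4 ^ a2 * 4 ^ a3) by pos.
  assert (EX := cbrt_cube _ PX). assert (Px := cbrt_pos (4 ^ a1 * 4 ^ a2 * 4 ^ a3)).
  set (x := cbrt (4 ^ a1 * 4 ^ a2 * 4 ^ a3)) in *. clearbody x.
  set (D := 7084800 * L ^ 2 * (x * (4 ^ b1 * 4 ^ b2 * 4 ^ b3))).
  assert (PD : 0 <= D) by (unfold D; pos).
  (* [d^3 X <= B] allows at most [be / x] values of [d], which cancels the factor [x] of the box
     bound. *)
  replace (7084800 * L ^ 2 * be * (4 ^ b1 * 4 ^ b2 * 4 ^ b3)) with ((be / x - 1 + 1) * D)
    by (unfold D; field; lra).
  apply at_most_fiber_Z with (f := pd); auto.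
  { replace (be / x - 1 + 1) with (be / x) by ring. pos. }
  { intros p ((((((((((Hp & _) & _) & _) & _) & _) & _) & _) & Ea2) & Ea3) & Ea1).
    assert (H := bb_A B p (HG p Hp)). assert (H1 := bb_d B p (HG p Hp)).
    split; [lra|]. apply Rle_div_r_of_mul; auto. unfold A_size in H.
    rewrite Ea1, Ea2, Ea3, EX, CB in H. apply cube_le; [lra|].
    rewrite Rpow_mult_distr. lra. }
  intros d. apply at_most_inhabited; auto.
  intros p (((((((((((Hp & E1) & E2) & E3) & Et) & Eb1) & Eb2) & Eb3) & Ea2) & Ea3) & Ea1) & Ed).
  assert (H1 := bb_a1 B p (HG p Hp)). assert (H2 := bb_a2 B p (HG p Hp)).
  assert (H3 := bb_a3 B p (HG p Hp)).
  destruct Hp as [_ Hthin]. unfold A_size, size1 in Hthin.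
  rewrite Ea1, Ea2, Ea3, E1, Eb1 in Hthin. rewrite Ea1 in H1. rewrite Ea2 in H2. rewrite Ea3 in H3.
  apply at_most_impl with (2 := at_most_thin_box d t c1 c2 c3 a1 a2 a3 b1 b2 b3 (4 * B) x
    H1 H2 H3 Px EX ltac:(lia) Hthin).
  clear p E1 E2 E3 Et Eb1 Eb2 Eb3 Ea2 Ea3 Ea1 Ed H1 H2 H3 Hthin.
  intros p (((((((((((Hp & E1) & E2) & E3) & Et) & Eb1) & Eb2) & Eb3) & Ea2) & Ea3) & Ea1) & Ed).
  split; [apply Hp|]. split; auto.
Qed.

(** * The parametrisation *)

(** These transpositions bring the largest of the three terms to the first place, so that [leading1]
    can be assumed at the cost of a factor 3. *)
Definition swap12 (p : param) : param :=
  Param (pd p) (pt p) (s2 p) (s1 p) (s3 p) (y2 p) (y1 p) (y3 p) (A2 p) (A1 p) (A3 p).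
Definition swap13 (p : param) : param :=
  Param (pd p) (pt p) (s3 p) (s2 p) (s1 p) (y3 p) (y2 p) (y1 p) (A3 p) (A2 p) (A1 p).

Lemma admissible_swap12 B p : admissible B p -> admissible B (swap12 p).
Proof.
  intros [[] Hd Ht HA Hy Hx1 Hx2 Hx3]. constructor; simpl; auto.
  - constructor; simpl; auto; try apply rel_prime_sym; auto. lia.
  - apply Rle_trans with (2 := HA). apply Req_le. ring.
  - apply Rle_trans with (2 := Hy). apply Req_le. ring.
  - apply Rle_trans with (2 := Hx2). apply Req_le. ring.
  - apply Rle_trans with (2 := Hx1). apply Req_le. ring.
  - apply Rle_trans with (2 := Hx3). apply Req_le. ring.
Qed.

Lemma admissible_swap13 B p : admissible B p -> admissible B (swap13 p).
Proof.
  intros [[] Hd Ht HA Hy Hx1 Hx2 Hx3]. constructor; simpl; auto.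
  - constructor; simpl; auto; try apply rel_prime_sym; auto. lia.
  - apply Rle_trans with (2 := HA). apply Req_le. ring.
  - apply Rle_trans with (2 := Hy). apply Req_le. ring.
  - apply Rle_trans with (2 := Hx3). apply Req_le. ring.
  - apply Rle_trans with (2 := Hx2). apply Req_le. ring.
  - apply Rle_trans with (2 := Hx1). apply Req_le. ring.
Qed.

Lemma swap12_involutive p : swap12 (swap12 p) = p.
Proof. destruct p; reflexivity. Qed.
Lemma swap13_involutive p : swap13 (swap13 p) = p.
Proof. destruct p; reflexivity. Qed.

Lemma at_most_leading1 B : 1 <= B ->
  at_most (fun p => admissible B p /\ leading1 p) (119755112448 * (B * (1 + ln (4 * B)) ^ 6)).
Proof.
  intros HB.
  apply at_most_le with (50331648 * B * (1 + ln (4 * B)) ^ 6 + 119704780800 * B * (1 + ln (4 * B)) ^ 6).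
  { apply Req_le. ring. }
  apply at_most_or with (2 := at_most_many_lattice_points B HB) (3 := at_most_few_lattice_points B HB).
  intros p Hp. destruct (Rle_lt_dec (size1 p) (A_size p)) as [H|H]; [left|right]; split; auto. lra.
Qed.

Lemma at_most_admissible B : 1 <= B ->
  at_most (admissible B) (3 * (119755112448 * (B * (1 + ln (4 * B)) ^ 6))).
Proof.
  intros HB. assert (H := at_most_leading1 B HB).
  set (K := 119755112448 * (B * (1 + ln (4 * B)) ^ 6)) in *.
  replace (3 * K) with (K + (K + K)) by ring.
  apply at_most_or with (Q1 := fun p => admissible B p /\ leading1 p)
    (Q2 := fun p => admissible B p /\ (leading1 (swap12 p) \/ leading1 (swap13 p))); auto.
  { intros p Hp. unfold leading1.
    change (size1 (swap12 p)) with (size2 p). change (size2 (swap12 p)) with (size1 p).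
    change (size3 (swap12 p)) with (size3 p). change (size1 (swap13 p)) with (size3 p).
    change (size2 (swap13 p)) with (size2 p). change (size3 (swap13 p)) with (size1 p).
    destruct (Rle_lt_dec (size1 p) (size2 p)), (Rle_lt_dec (size2 p) (size3 p)),
      (Rle_lt_dec (size1 p) (size3 p)); try (left; split; [auto|split; lra]);
      right; split; auto; try (left; split; lra); right; split; lra. }
  apply at_most_or with (Q1 := fun p => admissible B p /\ leading1 (swap12 p))
    (Q2 := fun p => admissible B p /\ leading1 (swap13 p)); [tauto| |].
  - apply at_most_inj with (f := swap12) (3 := H).
    + intros p [Hp Hl]. split; auto. apply admissible_swap12; auto.
    + intros p q _ _ E. rewrite <- (swap12_involutive p), E. apply swap12_involutive.
  - apply at_most_inj with (f := swap13) (3 := H).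
    + intros p [Hp Hl]. split; auto. apply admissible_swap13; auto.
    + intros p q _ _ E. rewrite <- (swap13_involutive p), E. apply swap13_involutive.
Qed.

(** * Factorisation of a primitive solution *)

Open Scope Z_scope.

Definition square_free (s : Z) : Prop := forall q, 0 < q -> (q ^ 2 | s) -> q = 1.

Lemma square_free_decomposition z : 0 < z ->
  exists s k, 0 < s /\ 0 < k /\ z = s * k ^ 2 /\ square_free s.
Proof.
  intros Hz. revert Hz. assert (H0 : 0 <= z \/ ~ 0 <= z) by lia.
  destruct H0 as [H0|]; [|lia]. revert z H0.
  apply (Z_lt_induction (fun z => 0 < z -> exists s k, 0 < s /\ 0 < k /\ z = s * k ^ 2 /\ square_free s)).
  intros z IH Hz.
  destruct (excluded_middle_informative (exists q, 1 < q /\ (q ^ 2 | z))) as [(q & Hq & z' & E)|N].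
  - assert (0 < z') by nia.
    destruct (IH z') as (s & k & Hs & Hk & Ek & Hsf); [nia|auto|].
    exists s, (k * q). split; [auto|]. split; [lia|]. split; [|auto]. rewrite E, Ek. ring.
  - exists z, 1. split; [auto|]. split; [lia|]. split; [lia|]. intros q Hq Hd.
    destruct (Z.eq_dec q 1); auto. exfalso. apply N. exists q. split; [lia|auto].
Qed.

Lemma pos_of_mul_pos a b : 0 < b -> 0 < a * b -> 0 < a.
Proof. intros Hb H. apply Z.mul_pos_cancel_r with b; auto. Qed.

Lemma gcd_cofactors a b : a <> 0 ->
  exists a' b', 0 < Z.gcd a b /\ a = a' * Z.gcd a b /\ b = b' * Z.gcd a b /\ rel_prime a' b'.
Proof.
  intros Ha. assert (Hg : 0 < Z.gcd a b).
  { assert (Z.gcd a b <> 0) by (intros E; apply Z.gcd_eq_0_l in E; auto).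
    generalize (Z.gcd_nonneg a b). lia. }
  destruct (Z.gcd_divide_l a b) as [a' Ea]. destruct (Z.gcd_divide_r a b) as [b' Eb].
  exists a', b'. split; [auto|]. split; [auto|]. split; [auto|].
  apply Zgcd_1_rel_prime.
  replace a' with (a / Z.gcd a b) by (rewrite Ea at 1; apply Z.div_mul; lia).
  replace b' with (b / Z.gcd a b) by (rewrite Eb at 1; apply Z.div_mul; lia).
  apply Z.gcd_div_gcd; [lia|auto].
Qed.

(** Remove [h = gcd s m] from both. The cofactor [s'] is coprime to that of [m], so it divides [h];
    then [s'^2] divides [s] and [s' = 1]. *)
Lemma square_free_dvd s m : 0 < s -> square_free s -> (s | m ^ 2) -> (s | m).
Proof.
  intros Hs Hsf Hd. destruct (gcd_cofactors s m) as (s' & m' & Hh & Es & Em & R); [lia|].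
  set (h := Z.gcd s m) in *. clearbody h.
  assert (Hs' : 0 < s') by (apply pos_of_mul_pos with h; congruence).
  assert (H1 : (s' | h)).
  { apply Gauss with (m' ^ 2).
    - destruct Hd as [k Hk]. exists k. apply Z.mul_reg_r with h; [lia|].
      rewrite Em, Es in Hk. clear - Hk. lia.
    - rewrite Z.pow_2_r. apply rel_prime_mult; auto. }
  assert (s' = 1).
  { apply Hsf; auto. destruct H1 as [k Hk]. exists k. rewrite Es, Hk. ring. }
  subst s'. exists m'. rewrite Em, Es. ring.
Qed.

Lemma sq_dvd_sq a b : a <> 0 -> (a ^ 2 | b ^ 2) -> (a | b).
Proof.
  intros Ha [k Hk]. destruct (gcd_cofactors a b) as (a' & b' & Hh & Ea & Eb & R); auto.
  set (h := Z.gcd a b) in *. clearbody h.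
  assert (E : b' ^ 2 = k * a' ^ 2).
  { apply Z.mul_reg_r with (h ^ 2); [nia|]. rewrite Ea, Eb in Hk.
    replace (b' ^ 2 * h ^ 2) with ((b' * h) ^ 2) by ring. rewrite Hk. ring. }
  assert (D : (a' | b')).
  { apply Gauss with b'; auto. exists (k * a'). rewrite <- Z.pow_2_r, E. ring. }
  destruct D as [l Hl]. exists l. rewrite Ea, Eb, Hl. ring.
Qed.

(** Greedy: [z1] is the gcd of [z] with [a], [z2] the gcd of the remaining factor with [b], and what
    is left divides [c] by Gauss. *)
Lemma distribute_factor a b c x z : a <> 0 -> b <> 0 -> c <> 0 -> 0 < z -> a * b * c = x * z ->
  exists z1 z2 z3 A1 A2 A3, 0 < z1 /\ 0 < z2 /\ 0 < z3 /\
    a = A1 * z1 /\ b = A2 * z2 /\ c = A3 * z3 /\ z = z1 * z2 * z3 /\ x = A1 * A2 * A3.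
Proof.
  intros Ha Hb Hc Hz E.
  destruct (gcd_cofactors a z) as (A1 & w & H1 & Ea & Ez & R1); auto.
  set (z1 := Z.gcd a z) in *. clearbody z1.
  assert (Hw : 0 < w) by nia.
  assert (E1 : A1 * (b * c) = x * w).
  { apply Z.mul_reg_r with z1; [lia|]. rewrite Ea, Ez in E. lia. }
  assert (D1 : (w | b * c)).
  { apply Gauss with A1; [exists x; auto|apply rel_prime_sym; auto]. }
  destruct D1 as [x' Hx'].
  assert (Ex : x = A1 * x').
  { apply Z.mul_reg_r with w; [lia|]. rewrite <- E1, Hx'. ring. }
  destruct (gcd_cofactors b w) as (A2 & z3 & H2 & Eb & Ew & R2); auto.
  set (z2 := Z.gcd b w) in *. clearbody z2.
  assert (H3 : 0 < z3) by nia.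
  assert (E2 : A2 * c = x' * z3).
  { apply Z.mul_reg_r with z2; [lia|]. rewrite Eb, Ew in Hx'. lia. }
  assert (D2 : (z3 | c)).
  { apply Gauss with A2; [exists x'; auto|apply rel_prime_sym; auto]. }
  destruct D2 as [A3 HA3].
  exists z1, z2, z3, A1, A2, A3. repeat split; auto.
  - rewrite Ez, Ew. ring.
  - rewrite Ex. rewrite <- Z.mul_assoc. f_equal. apply Z.mul_reg_r with z3; [lia|].
    rewrite <- E2, HA3. ring.
Qed.

Record represents (p : param) (x1 x2 x3 x4 : Z) : Prop := {
  rep_conic : on_conic p; rep_d : 0 < pd p; rep_t : 0 < pt p;
  rep_x1 : x1 = pd p * (s1 p * s2 p * s3 p) * pt p ^ 2 * (s1 p * A1 p * y1 p ^ 2);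
  rep_x2 : x2 = pd p * (s1 p * s2 p * s3 p) * pt p ^ 2 * (s2 p * A2 p * y2 p ^ 2);
  rep_x12 : - (x1 + x2) = pd p * (s1 p * s2 p * s3 p) * pt p ^ 2 * (s3 p * A3 p * y3 p ^ 2);
  rep_x4 : x4 = pd p ^ 3 * (A1 p * A2 p * A3 p);
  rep_y : Z.abs (x1 + x2 + x3) = (s1 p * s2 p * s3 p) ^ 2 * pt p ^ 3 * (y1 p * y2 p * y3 p) }.

Lemma rel_prime_pow a b n : 0 <= n -> rel_prime a b -> rel_prime (a ^ n) b.
Proof.
  intros Hn H. revert n Hn. apply natlike_ind.
  - apply rel_prime_1.
  - intros n Hn IH. rewrite Z.pow_succ_r by auto.
    apply rel_prime_sym, rel_prime_mult; apply rel_prime_sym; auto.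
Qed.

Lemma rel_prime_of_divisors a b : (forall g, (g | a) -> (g | b) -> (g | 1)) -> rel_prime a b.
Proof. intros H. constructor; [apply Z.divide_1_l|apply Z.divide_1_l|exact H]. Qed.

(** Let [d = gcd x1 x2], [d1 = gcd d x4] and [d = d2 d1]. Primitivity makes [d1] coprime to [y], so
    [d1^3] divides [x4 = x d1^3]; and [d2] is coprime to [x], so [y^2 = z d2^3]. What remains is
    [a b c' = x z]; [z] is distributed over the three coprime factors and each part is written
    [ui vi^2] with [ui] square-free. Then [d2 v1 v2 v3] divides [y], and the quotient [m] satisfies
    [m^2 = d2 s] with [s = u1 u2 u3]. As [s] is square-free it divides [m], and [m = t s] gives
    [d2 = s t^2]. Here [t] has the sign of [y], so the parameter is [|t|] and only [|y|] is
    recorded. *)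
Lemma represents_exists x1 x2 x3 x4 :
  primitive4 x1 x2 x3 x4 = true -> in_U2 x1 x2 x3 x4 = true ->
  exists p, represents p x1 x2 x3 x4.
Proof.
  unfold primitive4, in_U2, cubic_S2, on_six_lines.
  rewrite Z.eqb_eq. intros Hprim HU. apply andb_prop in HU. destruct HU as [HU HN].
  rewrite Z.eqb_eq in HU. rewrite Bool.negb_true_iff in HN.
  repeat (apply Bool.orb_false_iff in HN; destruct HN as [HN ?HN]).
  rewrite Bool.andb_false_iff, !Z.eqb_neq in *.
  set (c := - (x1 + x2)). set (y := x1 + x2 + x3) in *.
  assert (E : x1 * x2 * c = x4 * y ^ 2) by (unfold c; lia).
  (* [y = 0] or [x4 = 0] would make one of [x1], [x2], [x1 + x2] vanish; these six cases are the six
     lines, since [x1 + x2 = y = 0] means [x1 + x2 = x3 = 0]. *)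
  assert (Hy0 : y <> 0).
  { intros F. rewrite F in E. replace (x4 * 0 ^ 2) with 0 in E by ring.
    apply Z.mul_eq_0 in E. destruct E as [E|E]; [apply Z.mul_eq_0 in E|]; unfold c, y in *; lia. }
  assert (Hx40 : x4 <> 0).
  { intros F. rewrite F, Z.mul_0_l in E.
    apply Z.mul_eq_0 in E. destruct E as [E|E]; [apply Z.mul_eq_0 in E|]; unfold c, y in *; lia. }
  assert (Hn : x1 <> 0 /\ x2 <> 0 /\ c <> 0).
  { assert (0 <> x4 * y ^ 2).
    { intros F. symmetry in F. apply Z.mul_eq_0 in F. destruct F as [F|F]; [auto|].
      rewrite Z.pow_2_r in F. apply Z.mul_eq_0 in F. tauto. }
    rewrite <- E in H. repeat split; intros F; rewrite F in H; apply H; ring. }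
  destruct Hn as (Hx1 & Hx2 & Hc). clear HN HN0 HN1 HN2 HN3 HN4 HU.
  assert (Hg : forall g, (g | x1) -> (g | x2) -> (g | y) -> (g | x4) -> (g | 1)).
  { intros g G1 G2 G3 G4. rewrite <- Hprim. repeat apply Z.gcd_greatest; auto.
    replace x3 with (y - (x1 + x2)) by (unfold y; ring).
    apply Z.divide_sub_r; auto. apply Z.divide_add_r; auto. }
  destruct (gcd_cofactors x1 x2) as (a & b & Hd & Ea & Eb & Rab); auto.
  assert (Gd1 : (Z.gcd x1 x2 | x1)) by apply Z.gcd_divide_l.
  assert (Gd2 : (Z.gcd x1 x2 | x2)) by apply Z.gcd_divide_r.
  set (d := Z.gcd x1 x2) in *. clearbody d.
  set (c' := - (a + b)).
  assert (Ec : c = c' * d) by (unfold c, c'; rewrite Ea, Eb; ring).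
  destruct (gcd_cofactors d x4) as (d2 & e & Hd1 & Ed & Ex4 & Rd2e); [lia|].
  assert (Gd3 : (Z.gcd d x4 | d)) by apply Z.gcd_divide_l.
  assert (Gd4 : (Z.gcd d x4 | x4)) by apply Z.gcd_divide_r.
  set (d1 := Z.gcd d x4) in *. clearbody d1.
  assert (Hd2 : 0 < d2) by (apply pos_of_mul_pos with (2 := eq_ind _ (Z.lt 0) Hd _ Ed); auto).
  assert (Rd1y : rel_prime d1 y).
  { apply rel_prime_of_divisors. intros g G1 G2. apply Hg; auto.
    - apply Z.divide_trans with d1; auto. apply Z.divide_trans with d; auto.
    - apply Z.divide_trans with d1; auto. apply Z.divide_trans with d; auto.
    - apply Z.divide_trans with d1; auto. }
  assert (E1 : d1 ^ 3 * (d2 ^ 3 * (a * b * c')) = x4 * y ^ 2).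
  { rewrite <- E, Ec, Ea, Eb, Ed. ring. }
  assert (D1 : (d1 ^ 3 | x4)).
  { apply Gauss with (y ^ 2).
    - exists (d2 ^ 3 * (a * b * c')). rewrite Z.mul_comm, <- E1. ring.
    - apply rel_prime_pow; [lia|]. rewrite Z.pow_2_r. apply rel_prime_mult; auto. }
  destruct D1 as [x Hx].
  assert (Hd13 : d1 ^ 3 <> 0) by (apply Z.pow_nonzero; lia).
  assert (Rd2x : rel_prime d2 x).
  { apply rel_prime_dvd with (1 := Rd2e); [exists 1; ring|].
    exists (d1 ^ 2). apply Z.mul_reg_r with d1; [lia|]. rewrite <- Ex4, Hx. ring. }
  assert (E2 : d2 ^ 3 * (a * b * c') = x * y ^ 2).
  { apply Z.mul_reg_l with (d1 ^ 3); auto. rewrite E1, Hx. ring. }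
  assert (D2 : (d2 ^ 3 | y ^ 2)).
  { apply Gauss with x; [exists (a * b * c'); rewrite <- E2; ring|apply rel_prime_pow; auto; lia]. }
  destruct D2 as [z Hz].
  assert (Hd23 : 0 < d2 ^ 3) by (apply Z.pow_pos_nonneg; lia).
  assert (Hz0 : 0 < z).
  { apply pos_of_mul_pos with (d2 ^ 3); auto. rewrite <- Hz, Z.pow_2_r.
    generalize (Z.square_nonneg y). assert (y * y <> 0) by (intros F; apply Z.mul_eq_0 in F; tauto). lia. }
  assert (E3 : a * b * c' = x * z).
  { apply Z.mul_reg_l with (d2 ^ 3); [lia|]. rewrite E2, Hz. ring. }
  assert (Ha : a <> 0) by (intros F; apply Hx1; rewrite Ea, F; ring).
  assert (Hb : b <> 0) by (intros F; apply Hx2; rewrite Eb, F; ring).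
  assert (Hc' : c' <> 0) by (intros F; apply Hc; rewrite Ec, F; ring).
  destruct (distribute_factor a b c' x z Ha Hb Hc' Hz0 E3)
    as (z1 & z2 & z3 & B1 & B2 & B3 & Z1 & Z2 & Z3 & F1 & F2 & F3 & Fz & Fx).
  destruct (square_free_decomposition z1 Z1) as (u1 & v1 & U1 & V1 & W1 & Q1).
  destruct (square_free_decomposition z2 Z2) as (u2 & v2 & U2 & V2 & W2 & Q2).
  destruct (square_free_decomposition z3 Z3) as (u3 & v3 & U3 & V3 & W3 & Q3).
  assert (Rac : rel_prime a c').
  { apply rel_prime_of_divisors. intros g G1 G2.
    destruct Rab as [_ _ Rab]. apply Rab; auto.
    replace b with (- c' - a) by (unfold c'; ring).
    apply Z.divide_sub_r; auto. apply Z.divide_opp_r; auto. }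
  assert (Rbc : rel_prime b c').
  { apply rel_prime_of_divisors. intros g G1 G2.
    destruct Rab as [_ _ Rab]. apply Rab; auto.
    replace a with (- c' - b) by (unfold c'; ring).
    apply Z.divide_sub_r; auto. apply Z.divide_opp_r; auto. }
  assert (K1 : a = u1 * B1 * v1 ^ 2) by (rewrite F1, W1; ring).
  assert (K2 : b = u2 * B2 * v2 ^ 2) by (rewrite F2, W2; ring).
  assert (K3 : c' = u3 * B3 * v3 ^ 2) by (rewrite F3, W3; ring).
  set (k := v1 * v2 * v3).
  assert (Hk : 0 < k) by (unfold k; repeat apply Z.mul_pos_pos; auto).
  assert (Hdk : d2 * k <> 0) by (intros F; apply Z.mul_eq_0 in F; lia).
  assert (D3 : (d2 * k | y)).
  { apply sq_dvd_sq; auto. exists (d2 * (u1 * u2 * u3)).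
    rewrite Hz, Fz, W1, W2, W3. unfold k. ring. }
  destruct D3 as [m Hm].
  assert (Em : m ^ 2 = d2 * (u1 * u2 * u3)).
  { apply Z.mul_reg_r with ((d2 * k) ^ 2); [apply Z.pow_nonzero; auto; lia|].
    transitivity (y ^ 2); [rewrite Hm; ring|]. rewrite Hz, Fz, W1, W2, W3. unfold k. ring. }
  assert (Dm : (u1 * u2 * u3 | m)).
  { assert (R12 : rel_prime u1 u2).
    { apply rel_prime_dvd with (1 := Rab);
        [exists (B1 * v1 ^ 2); rewrite K1|exists (B2 * v2 ^ 2); rewrite K2]; ring. }
    assert (R13 : rel_prime u1 u3).
    { apply rel_prime_dvd with (1 := Rac);
        [exists (B1 * v1 ^ 2); rewrite K1|exists (B3 * v3 ^ 2); rewrite K3]; ring. }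
    assert (R23 : rel_prime u2 u3).
    { apply rel_prime_dvd with (1 := Rbc);
        [exists (B2 * v2 ^ 2); rewrite K2|exists (B3 * v3 ^ 2); rewrite K3]; ring. }
    apply rel_prime_mul_dvd; [|apply rel_prime_mul_dvd; auto|].
    - apply rel_prime_sym, rel_prime_mult; apply rel_prime_sym; auto.
    - apply square_free_dvd; auto. rewrite Em. exists (d2 * u2 * u3). ring.
    - apply square_free_dvd; auto. rewrite Em. exists (d2 * u1 * u3). ring.
    - apply square_free_dvd; auto. rewrite Em. exists (d2 * u1 * u2). ring. }
  destruct Dm as [t Ht].
  set (s := u1 * u2 * u3) in *.
  assert (Hs : 0 < s) by (unfold s; repeat apply Z.mul_pos_pos; auto).
  assert (Ed2 : d2 = s * t ^ 2).
  { apply Z.mul_reg_r with s; [lia|]. rewrite <- Em, Ht. ring. }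
  assert (Ht0 : t <> 0) by (intros F; rewrite F in Ed2; lia).
  assert (Et : t ^ 2 = Z.abs t ^ 2).
  { rewrite !Z.pow_2_r. symmetry. apply Z.abs_square. }
  exists (Param d1 (Z.abs t) u1 u2 u3 v1 v2 v3 B1 B2 B3).
  constructor; cbn [pd pt s1 s2 s3 y1 y2 y3 A1 A2 A3]; auto; try fold s.
  - constructor; cbn [pd pt s1 s2 s3 y1 y2 y3 A1 A2 A3]; auto.
    + intros F. apply Ha. rewrite F1, F. ring.
    + intros F. apply Hb. rewrite F2, F. ring.
    + intros F. apply Hc'. rewrite F3, F. ring.
    + rewrite <- K1, <- K2, <- K3. unfold c'. ring.
    + apply rel_prime_dvd with (1 := Rab); [exists v1; rewrite K1|exists v2; rewrite K2]; ring.
    + apply rel_prime_dvd with (1 := Rac); [exists v1; rewrite K1|exists v3; rewrite K3]; ring.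
    + apply rel_prime_dvd with (1 := Rbc); [exists v2; rewrite K2|exists v3; rewrite K3]; ring.
  - apply Z.abs_pos; auto.
  - rewrite <- Et, <- K1, <- Z.mul_assoc, <- Z.mul_assoc, (Z.mul_assoc s), <- Ed2, Ea, Ed. ring.
  - rewrite <- Et, <- K2, <- Z.mul_assoc, <- Z.mul_assoc, (Z.mul_assoc s), <- Ed2, Eb, Ed. ring.
  - rewrite <- Et, <- K3, <- Z.mul_assoc, <- Z.mul_assoc, (Z.mul_assoc s), <- Ed2. fold c. rewrite Ec, Ed. ring.
  - rewrite Hx, Fx. ring.
  - fold y k. rewrite Hm, Ht, Ed2, Et. rewrite !Z.abs_mul, (Z.abs_eq s), (Z.abs_eq k) by (apply Z.lt_le_incl; auto).
    rewrite (Z.abs_eq (Z.abs t ^ 2)) by (apply Z.pow_nonneg, Z.abs_nonneg). ring.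
Qed.

(** * From rational points to admissible parameters *)

Open Scope R_scope.

Lemma abs_le_height4 x1 x2 x3 x4 :
  (Z.abs x1 <= height4 x1 x2 x3 x4 /\ Z.abs x2 <= height4 x1 x2 x3 x4 /\
   Z.abs x3 <= height4 x1 x2 x3 x4 /\ Z.abs x4 <= height4 x1 x2 x3 x4)%Z.
Proof. unfold height4. lia. Qed.

Lemma represents_admissible B p x1 x2 x3 x4 :
  represents p x1 x2 x3 x4 -> IZR (height4 x1 x2 x3 x4) <= B -> admissible B p.
Proof.
  intros [Hp Hd Ht E1 E2 E3 E4 Ey] Hh.
  assert (H0 : forall x, (Z.abs x <= height4 x1 x2 x3 x4)%Z -> Rabs (IZR x) <= B).
  { intros x Hx. rewrite <- abs_IZR. apply IZR_le in Hx. lra. }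
  destruct (abs_le_height4 x1 x2 x3 x4) as (H1 & H2 & H3 & H4).
  apply H0 in H1. apply H0 in H2. apply H0 in H3. apply H0 in H4.
  assert (Habs : forall x r, Rabs x <= r -> - r <= x <= r).
  { intros x r. generalize (Rle_abs x) (Rle_abs (- x)). rewrite Rabs_Ropp. lra. }
  assert (Pd : 0 <= IZR (pd p)) by (apply IZR_le, Z.lt_le_incl; auto).
  assert (Pt : 0 <= IZR (pt p)) by (apply IZR_le, Z.lt_le_incl; auto).
  assert (Ps1 : 0 <= IZR (s1 p)) by (apply IZR_le; apply Z.lt_le_incl, Hp).
  assert (Ps2 : 0 <= IZR (s2 p)) by (apply IZR_le; apply Z.lt_le_incl, Hp).
  assert (Ps3 : 0 <= IZR (s3 p)) by (apply IZR_le; apply Z.lt_le_incl, Hp).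
  assert (Hx : forall x s A y, 0 <= IZR s -> Rabs (IZR x) <= 2 * B ->
    x = (pd p * (s1 p * s2 p * s3 p) * pt p ^ 2 * (s * A * y ^ 2))%Z ->
    IZR (pd p) * (IZR (s1 p) * IZR (s2 p) * IZR (s3 p)) * IZR (pt p) ^ 2
      * (IZR s * Rabs (IZR A) * IZR y ^ 2) <= 2 * B).
  { intros x s A y Hs Hb E. apply Rle_trans with (2 := Hb). apply Req_le. symmetry. rewrite E.
    rewrite !Z.pow_2_r, !mult_IZR, !Rabs_mult.
    rewrite (Rabs_pos_eq (IZR (pd p))), (Rabs_pos_eq (IZR (pt p))), (Rabs_pos_eq (IZR (s1 p))),
      (Rabs_pos_eq (IZR (s2 p))), (Rabs_pos_eq (IZR (s3 p))), (Rabs_pos_eq (IZR s)) by auto.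
    replace (Rabs (IZR y) * Rabs (IZR y)) with (IZR y ^ 2); [ring|].
    rewrite <- Rabs_mult. rewrite Rabs_pos_eq by apply Rle_0_sqr. ring. }
  apply Habs in H1 as H1'. apply Habs in H2 as H2'. apply Habs in H3 as H3'.
  constructor; auto.
  - apply Rle_trans with (2 := H4). apply Req_le. symmetry. rewrite E4.
    replace (pd p ^ 3)%Z with (pd p * pd p * pd p)%Z by ring.
    rewrite !mult_IZR, !Rabs_mult, (Rabs_pos_eq (IZR (pd p))) by auto. ring.
  - apply Rle_trans with (IZR (Z.abs (x1 + x2 + x3))).
    + rewrite Ey. replace (pt p ^ 3)%Z with (pt p * pt p * pt p)%Z by ring.
      rewrite Z.pow_2_r, !mult_IZR. apply Req_le. ring.
    + rewrite abs_IZR, !plus_IZR. apply Rabs_le. lra.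
  - apply Hx with x1; auto. lra.
  - apply Hx with x2; auto. lra.
  - apply Hx with (- (x1 + x2))%Z; auto. rewrite opp_IZR, Rabs_Ropp, plus_IZR. apply Rabs_le. lra.
Qed.

Definition counted (B : R) (v : Z * Z * Z * Z) : Prop :=
  let '(x1, x2, x3, x4) := v in
  primitive4 x1 x2 x3 x4 = true /\ in_U2 x1 x2 x3 x4 = true /\ IZR (height4 x1 x2 x3 x4) <= B.

Definition y_sign (v : Z * Z * Z * Z) : Z :=
  let '(x1, x2, x3, x4) := v in Z.sgn (x1 + x2 + x3).

(** The parameters determine [x1], [x2], [x4] and [|x1 + x2 + x3|], so they determine the point once
    the sign of [x1 + x2 + x3] is fixed. The 9 is three values of this sign times the 3 of
    [at_most_admissible]. *)
Lemma at_most_counted B : 1 <= B ->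
  at_most (counted B) (9 * (119755112448 * (B * (1 + ln (4 * B)) ^ 6))).
Proof.
  intros HB. assert (H := at_most_admissible B HB).
  set (K := 119755112448 * (B * (1 + ln (4 * B)) ^ 6)) in *.
  assert (HK : 0 <= K).
  { unfold K. assert (0 <= ln (4 * B)) by (apply ln_nonneg; lra). pos. }
  replace (9 * K) with ((1 - -1 + 1) * (3 * K)) by ring.
  apply at_most_fiber_Z with (f := y_sign); [lra|lra| |].
  { intros [[[x1 x2] x3] x4] _. apply sgn_range. }
  intros sg.
  set (rep := fun v : Z * Z * Z * Z => let '(x1, x2, x3, x4) := v in
    epsilon (inhabits (Param 0 0 0 0 0 0 0 0 0 0 0)) (fun p => represents p x1 x2 x3 x4)).
  assert (Hrep : forall x1 x2 x3 x4, counted B (x1, x2, x3, x4) ->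
    represents (rep (x1, x2, x3, x4)) x1 x2 x3 x4).
  { intros x1 x2 x3 x4 (H1 & H2 & _). unfold rep. apply epsilon_spec.
    apply represents_exists; auto. }
  apply at_most_inj with (f := rep) (3 := H).
  - intros [[[x1 x2] x3] x4] [Hv _]. apply represents_admissible with (1 := Hrep _ _ _ _ Hv).
    apply Hv.
  - intros [[[x1 x2] x3] x4] [[[z1 z2] z3] z4] [Hv Hsgn] [Hw Hsgn'] E.
    apply Hrep in Hv. apply Hrep in Hw. rewrite E in Hv. destruct Hv, Hw.
    simpl in Hsgn, Hsgn'. assert (H0 : Z.abs (x1 + x2 + x3) = Z.abs (z1 + z2 + z3)) by congruence.
    assert (H1 : x1 = z1) by congruence. assert (H2 : x2 = z2) by congruence. assert (x4 = z4) by congruence.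
    assert (H4 : (x1 + x2 + x3 = z1 + z2 + z3)%Z).
    { rewrite <- (Z.abs_sgn (x1 + x2 + x3)), <- (Z.abs_sgn (z1 + z2 + z3)). congruence. }
    assert (x3 = z3) by (clear - H1 H2 H4; lia). congruence.
Qed.

Lemma NoDup_list_prod {S T} (l : list S) (m : list T) :
  NoDup l -> NoDup m -> NoDup (list_prod l m).
Proof.
  intros Hl Hm. induction Hl as [|a l Ha Hl IH]; simpl; [constructor|].
  apply NoDup_app; auto.
  - apply NoDup_map_NoDup_ForallPairs; auto. intros x y _ _ E. congruence.
  - intros [x y] Hx. apply in_map_iff in Hx. destruct Hx as (b & E & _). inversion E; subst.
    intros F. apply in_prod_iff in F. tauto.
Qed.

Lemma NoDup_zbox M : NoDup (zbox M).
Proof.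
  apply NoDup_map_NoDup_ForallPairs; [|apply seq_NoDup]. intros x y _ _ E. lia.
Qed.

Theorem theorem1p9 :
  exists c : R, 0 < c /\
    forall B : R, 2 <= B -> INR (N_U2 B) <= c * B * (ln B) ^ 6.
Proof.
  exists (9 * 119755112448 * 5 ^ 6). split; [lra|]. intros B HB.
  (* Both 1 and [ln 4] are at most [2 ln 2 <= 2 ln B], whence the factor 5. *)
  assert (Hln : 1 + ln (4 * B) <= 5 * ln B).
  { rewrite ln_mult by lra. replace 4 with (2 * 2) by ring. rewrite ln_mult by lra.
    assert (ln 2 <= ln B) by (destruct HB as [HB|<-]; [left; apply ln_increasing; lra|lra]).
    generalize ln_lt_2. lra. }
  assert (Hln0 : 0 <= ln (4 * B)) by (apply ln_nonneg; lra).
  apply Rle_trans with (9 * (119755112448 * (B * (1 + ln (4 * B)) ^ 6))).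
  - unfold N_U2. apply at_most_counted; [lra| |].
    + apply NoDup_filter. repeat apply NoDup_list_prod; apply NoDup_zbox.
    + intros [[[x1 x2] x3] x4] Hx. apply filter_In in Hx. destruct Hx as [_ Hx].
      apply andb_prop in Hx. destruct Hx as [Hx H4]. apply andb_prop in Hx. destruct Hx as [Hx H3].
      apply andb_prop in Hx. destruct Hx as [H1 H2].
      destruct (Rle_dec (IZR (height4 x1 x2 x3 x4)) B); [|discriminate].
      split; auto.
  - assert (Hp : (1 + ln (4 * B)) ^ 6 <= (5 * ln B) ^ 6) by (apply pow_incr; lra).
    rewrite Rpow_mult_distr in Hp.
    assert (B * (1 + ln (4 * B)) ^ 6 <= B * (5 ^ 6 * ln B ^ 6)) by (apply Rmult_le_compat_l; lra).
    lra.
Qed.
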